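(* Let $\mathbb K$ be a commutative ring and $V$ a $\mathbb K$-module. The unit, the counit, the external product $*$ and the coproduct $\Delta$ defined below endow $\mathscr F(V)=\bigoplus_{n\geq0}\mathscr F_n(V)$ with the structure of a graded bialgebra over $\mathbb K$.
   Context: For $n\geq0$, $\mathfrak S_n$ is the symmetric group on $\{1,\dots,n\}$ ($\mathfrak S_0$ trivial), with unit $e_n$; permutations are written as words $\sigma(1)\sigma(2)\cdots\sigma(n)$. For a composition $\mathbf c=(c_1,\dots,c_k)$ of $n$ with $t_i=c_1+\dots+c_i$, let $X_{\mathbf c}$ be the set of $\sigma\in\mathfrak S_n$ increasing on each interval $[t_{i-1}+1,t_i]$ and $x_{\mathbf c}=\sum_{\sigma\in X_{\mathbf c}}\sigma\in\mathbb K\mathfrak S_n$. For $\sigma\in\mathfrak S_n,\sigma'\in\mathfrak S_{n'}$, $\sigma\times\sigma'\in\mathfrak S_{n+n'}$ equals $\sigma$ on $[1,n]$ and sends $a\in[n+1,n+n']$ to $n+\sigma'(a-n)$. The standardization of a word $a_1\cdots a_m$ over a totally ordered alphabet is the permutation obtained by replacing its letters by $1,\dots,m$, the smallest letters first and equal letters from left to right. $\mathscr F_n(V)=V^{\otimes n}\otimes\mathbb K\mathfrak S_n$, whose elements $(v_1\otimes\cdots\otimes v_n)\otimes\sigma$ are written $(v_1\otimes\cdots\otimes v_n)\#\sigma$; $\mathbb K\mathfrak S_n$ acts on the left by $\pi\cdot[(v_1\otimes\cdots\otimes v_n)\#\sigma]=[(v_{\pi^{-1}(1)}\otimes\cdots\otimes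 v_{\pi^{-1}(n)})\#(\pi\sigma)]$ (extended linearly). External product: for $\alpha=(v_1\otimes\cdots\otimes v_n)\#\sigma$ and $\alpha'=(v'_1\otimes\cdots\otimes v'_{n'})\#\sigma'$, $\alpha*\alpha'=x_{(n,n')}\cdot[(v_1\otimes\cdots\otimes v_n\otimes v'_1\otimes\cdots\otimes v'_{n'})\#(\sigma\times\sigma')]$, extended bilinearly. Coproduct: $\Delta((v_1\otimes\cdots\otimes v_n)\#\sigma)=\sum_{n'=0}^n[(v_1\otimes\cdots\otimes v_{n'})\#\pi_{n'}]\otimes[(v_{n'+1}\otimes\cdots\otimes v_n)\#\pi'_{n-n'}]$, where $\pi_{n'}\in\mathfrak S_{n'}$ is the inverse of the standardization of the word $\sigma^{-1}(1)\cdots\sigma^{-1}(n')$ and $\pi'_{n-n'}\in\mathfrak S_{n-n'}$ is the inverse of the standardization of $\sigma^{-1}(n'+1)\cdots\sigma^{-1}(n)$. The unit is the inclusion of $\mathscr F_0(V)=\mathbb K$, the counit the projection onto $\mathscr F_0(V)=\mathbb K$. *)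

(* Defs.v *)
From HB Require Import structures.
From mathcomp Require Import all_boot all_order all_fingroup all_algebra.
From mathcomp Require Import generic_quotient boolp.

Set Implicit Arguments.
Unset Strict Implicit.
Unset Printing Implicit Defensive.

Import Order.TTheory GRing.Theory.

Local Open Scope ring_scope.
Local Open Scope quotient_scope.

Definition linof (K : pzRingType) (U W : lmodType K) (f : U -> W)
    (Hf : linear f) : {linear U -> W} :=
  HB.pack f (GRing.isLinear.Build K U W *:%R f Hf).

(** [presented r] is the K-module generated by the symbols [PGen x], x : X,
    subject to the relations [r]: formal expressions modulo the least
    congruence [peqv r] that contains [r] and the module axioms. *)

Section Presented.
Variables (K : comPzRingType) (X : Type).

Inductive pexpr : Type :=
  | PGen of X
  | PZero
  | PAdd of pexpr & pexpr
  | POpp of pexpr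
  | PScale of K & pexpr.

HB.instance Definition _ := gen_eqMixin pexpr.
HB.instance Definition _ := gen_choiceMixin pexpr.

Variable r : pexpr -> pexpr -> Prop.

Inductive peqv : pexpr -> pexpr -> Prop :=
  | peqv_rel e e' : r e e' -> peqv e e'
  | peqv_refl e : peqv e e
  | peqv_sym e e' : peqv e e' -> peqv e' e
  | peqv_trans e1 e2 e3 : peqv e1 e2 -> peqv e2 e3 -> peqv e1 e3
  | peqv_add e1 e1' e2 e2' : peqv e1 e1' -> peqv e2 e2' ->
      peqv (PAdd e1 e2) (PAdd e1' e2')
  | peqv_opp e e' : peqv e e' -> peqv (POpp e) (POpp e')
  | peqv_scale a e e' : peqv e e' -> peqv (PScale a e) (PScale a e')
  | peqv_addA e1 e2 e3 :
      peqv (PAdd e1 (PAdd e2 e3)) (PAdd (PAdd e1 e2) e3)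
  | peqv_addC e1 e2 : peqv (PAdd e1 e2) (PAdd e2 e1)
  | peqv_add0 e : peqv (PAdd PZero e) e
  | peqv_addN e : peqv (PAdd (POpp e) e) PZero
  | peqv_scaleA a b e : peqv (PScale a (PScale b e)) (PScale (a * b) e)
  | peqv_scale1 e : peqv (PScale 1 e) e
  | peqv_scaleDr a e1 e2 :
      peqv (PScale a (PAdd e1 e2)) (PAdd (PScale a e1) (PScale a e2))
  | peqv_scaleDl a b e :
      peqv (PScale (a + b) e) (PAdd (PScale a e) (PScale b e)).

Definition peqvb (e e' : pexpr) : bool := `[< peqv e e' >].

Lemma peqvb_refl : reflexive peqvb.
Proof. by move=> e; apply/asboolP; exact: peqv_refl. Qed.

Lemma peqvb_sym : symmetric peqvb.
Proof. by move=> e e'; apply/asboolP/asboolP; exact: peqv_sym. Qed.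

Lemma peqvb_trans : transitive peqvb.
Proof.
move=> e2 e1 e3 /asboolP h /asboolP h'; apply/asboolP; exact: peqv_trans h h'.
Qed.

Canonical peqvb_equiv := EquivRel peqvb peqvb_refl peqvb_sym peqvb_trans.

Definition presented := {eq_quot peqvb_equiv}.
HB.instance Definition _ := Choice.on presented.

Definition ppi (e : pexpr) : presented := \pi_presented e.
Definition prepr (p : presented) : pexpr := repr p.

Lemma preprK p : ppi (prepr p) = p. Proof. exact: reprK. Qed.

Lemma ppiP e e' : ppi e = ppi e' <-> peqv e e'.
Proof.
split=> [/eqmodP/asboolP //|h]; apply/eqmodP; exact/asboolP.
Qed.

Lemma prepr_ppi e : peqv (prepr (ppi e)) e.
Proof. by apply/ppiP; rewrite preprK. Qed.

Definition pzero : presented := ppi PZero.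
Definition padd (p q : presented) : presented := ppi (PAdd (prepr p) (prepr q)).
Definition popp (p : presented) : presented := ppi (POpp (prepr p)).
Definition pscale (a : K) (p : presented) : presented :=
  ppi (PScale a (prepr p)).

Lemma ppi_add e e' : ppi (PAdd e e') = padd (ppi e) (ppi e').
Proof. apply/esym/ppiP/peqv_add; exact: prepr_ppi. Qed.

Lemma ppi_opp e : ppi (POpp e) = popp (ppi e).
Proof. apply/esym/ppiP/peqv_opp; exact: prepr_ppi. Qed.

Lemma ppi_scale a e : ppi (PScale a e) = pscale a (ppi e).
Proof. apply/esym/ppiP/peqv_scale; exact: prepr_ppi. Qed.

Lemma paddA : associative padd.
Proof.
move=> p q s; rewrite -(preprK p) -(preprK q) -(preprK s) -!ppi_add.
exact/ppiP/peqv_addA.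
Qed.

Lemma paddC : commutative padd.
Proof.
by move=> p q; rewrite -(preprK p) -(preprK q) -!ppi_add; apply/ppiP/peqv_addC.
Qed.

Lemma padd0 : left_id pzero padd.
Proof. by move=> p; rewrite -(preprK p) -ppi_add; apply/ppiP/peqv_add0. Qed.

Lemma paddN : left_inverse pzero popp padd.
Proof.
by move=> p; rewrite -(preprK p) -ppi_opp -ppi_add; apply/ppiP/peqv_addN.
Qed.

HB.instance Definition _ :=
  GRing.isZmodule.Build presented paddA paddC padd0 paddN.

Lemma pscaleA a b p : pscale a (pscale b p) = pscale (a * b) p.
Proof. by rewrite -(preprK p) -!ppi_scale; apply/ppiP/peqv_scaleA. Qed.

Lemma pscale1 : left_id 1 pscale.
Proof. by move=> p; rewrite -(preprK p) -!ppi_scale; apply/ppiP/peqv_scale1. Qed.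

Lemma pscaleDr : right_distributive pscale +%R.
Proof.
move=> a p q; rewrite -(preprK p) -(preprK q).
by rewrite -[_ + _]ppi_add -!ppi_scale -[RHS]ppi_add; apply/ppiP/peqv_scaleDr.
Qed.

Lemma pscaleDl p : {morph pscale^~ p : a b / a + b}.
Proof.
move=> a b /=; rewrite -(preprK p) -!ppi_scale -[RHS]ppi_add.
exact/ppiP/peqv_scaleDl.
Qed.

HB.instance Definition _ := GRing.Zmodule_isLmodule.Build K presented
  pscaleA pscale1 pscaleDr pscaleDl.

Definition pgen (x : X) : presented := ppi (PGen x).

Fixpoint peval (W : lmodType K) (f : X -> W) (e : pexpr) : W :=
  match e with
  | PGen x => f x
  | PZero => 0
  | PAdd e1 e2 => peval f e1 + peval f e2
  | POpp e1 => - peval f e1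
  | PScale a e1 => a *: peval f e1
  end.

(* The linear extension of [f]; it is meaningful when [f] satisfies the
   relations, see [pextE] and [pext_linear]. *)
Definition pext (W : lmodType K) (f : X -> W) (p : presented) : W :=
  peval f (prepr p).

Lemma ppiE :
  [/\ ppi PZero = 0, forall e e', ppi (PAdd e e') = ppi e + ppi e',
      forall e, ppi (POpp e) = - ppi e
    & forall a e, ppi (PScale a e) = a *: ppi e].
Proof. by split=> *; rewrite ?ppi_add ?ppi_opp ?ppi_scale. Qed.

Section Ext.
Variables (W : lmodType K) (f : X -> W).
Hypothesis Hf : forall e e', r e e' -> peval f e = peval f e'.

Lemma peval_peqv e e' : peqv e e' -> peval f e = peval f e'.
Proof.
elim=> /=.
- exact: Hf.
- by [].
- by move=> ? ? _ ->.
- by move=> ? ? ? _ -> _ ->.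
- by move=> ? ? ? ? _ -> _ ->.
- by move=> ? ? _ ->.
- by move=> ? ? ? _ ->.
- by move=> *; rewrite addrA.
- by move=> *; rewrite addrC.
- by move=> *; rewrite add0r.
- by move=> *; rewrite addNr.
- by move=> *; rewrite scalerA.
- by move=> *; rewrite scale1r.
- by move=> *; rewrite scalerDr.
- by move=> *; rewrite scalerDl.
Qed.

Lemma pext_ppi e : pext f (ppi e) = peval f e.
Proof. exact/peval_peqv/prepr_ppi. Qed.

Lemma pextE x : pext f (pgen x) = f x.
Proof. exact: pext_ppi. Qed.

Lemma pext_linear : linear (pext f).
Proof.
have [_ D _ S] := ppiE.
by move=> a p q; rewrite -(preprK p) -(preprK q) -S -D !pext_ppi.
Qed.

End Ext.

Lemma pres_ind (P : presented -> Prop) :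
  (forall x, P (pgen x)) -> P 0 -> (forall a p q, P p -> P q -> P (a *: p + q)) ->
  forall p, P p.
Proof.
move=> Pg P0 PL p; rewrite -(preprK p); have [Z D N S] := ppiE.
elim: (prepr p) => [x||e IH e' IH'|e IH|a e IH]; first exact: Pg.
- by rewrite Z.
- by rewrite D -[ppi e]scale1r; apply: PL.
- by rewrite N -scaleN1r -[_ *: _]addr0; apply: PL.
- by rewrite S -[_ *: _]addr0; apply: PL.
Qed.

Lemma pext_uniq (W : lmodType K) (g h : {linear presented -> W}) :
  (forall x, g (pgen x) = h (pgen x)) -> forall p, g p = h p.
Proof.
move=> E; apply: pres_ind => // [|a p q Hp Hq]; first by rewrite !linear0.
by rewrite !linearP Hp Hq.
Qed.

(* [pext] is linear in the function it extends. *)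
Lemma pext_fun_linear (W : lmodType K) (f g h : X -> W) a :
  (forall x, f x = a *: g x + h x) ->
  forall p, pext f p = a *: pext g p + pext h p.
Proof.
move=> E p; rewrite /pext; elim: (prepr p) => //= [|e -> e' ->|e ->|b e ->].
- by rewrite scaler0 addr0.
- by rewrite scalerDr addrACA.
- by rewrite scalerN opprD.
- by rewrite scalerDr !scalerA mulrC.
Qed.

End Presented.

Arguments PZero {K X}.

Section Tensor.
Variables (K : comPzRingType) (M N : lmodType K).

Definition bilin (W : lmodType K) (f : M -> N -> W) : Prop :=
  (forall y, linear (f^~ y)) /\ (forall x, linear (f x)).

Inductive tens_rel : pexpr K (M * N) -> pexpr K (M * N) -> Prop :=
  | tens_rel_l a x x' y : tens_rel (PGen K (a *: x + x', y))
      (PAdd (PScale a (PGen K (x, y))) (PGen K (x', y)))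
  | tens_rel_r a x y y' : tens_rel (PGen K (x, a *: y + y'))
      (PAdd (PScale a (PGen K (x, y))) (PGen K (x, y'))).

Definition tens : lmodType K := presented tens_rel.

Definition tpure (x : M) (y : N) : tens := pgen tens_rel (x, y).

Definition text (W : lmodType K) (f : M -> N -> W) : tens -> W :=
  @pext K _ tens_rel W (fun xy => f xy.1 xy.2).

Lemma tpure_bilin : bilin tpure.
Proof.
have [_ D _ S] := ppiE tens_rel.
by split=> [y|x] a u v; rewrite /tpure /pgen -S -D; apply/ppiP/peqv_rel;
  constructor.
Qed.

Section Ext.
Variables (W : lmodType K) (f : M -> N -> W).
Hypothesis Hf : bilin f.

Lemma text_rel e e' : tens_rel e e' ->
  peval (fun xy => f xy.1 xy.2) e = peval (fun xy => f xy.1 xy.2) e'.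
Proof. by case=> * /=; [rewrite (Hf.1 _) | rewrite (Hf.2 _)]. Qed.

Lemma textE x y : text f (tpure x y) = f x y.
Proof. exact: (pextE text_rel). Qed.

Lemma text_linear : linear (text f).
Proof. exact: (pext_linear text_rel). Qed.

End Ext.

Lemma tens_ind (P : tens -> Prop) :
  (forall x y, P (tpure x y)) -> P 0 ->
  (forall a p q, P p -> P q -> P (a *: p + q)) -> forall p, P p.
Proof. by move=> Pg P0 PL; apply: pres_ind => // -[x y]; exact: Pg. Qed.

Lemma text_uniq (W : lmodType K) (g h : {linear tens -> W}) :
  (forall x y, g (tpure x y) = h (tpure x y)) -> forall p, g p = h p.
Proof. by move=> E; apply: pext_uniq => -[x y]; exact: E. Qed.

Lemma text_fun_linear (W : lmodType K) (f g h : M -> N -> W) a :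
  (forall x y, f x y = a *: g x y + h x y) ->
  forall p, text f p = a *: text g p + text h p.
Proof. by move=> E; apply: pext_fun_linear => -[x y]; exact: E. Qed.

End Tensor.

Notation "x \ox y" := (tpure x y) (at level 40, left associativity) : ring_scope.

Section TensorMaps.
Variable K : comPzRingType.

Definition tmap (M M' N N' : lmodType K) (f : M -> M') (g : N -> N') :
    tens M N -> tens M' N' :=
  text (fun x y => f x \ox g y).

Definition tassoc (M N P : lmodType K) :
    tens (tens M N) P -> tens M (tens N P) :=
  text (fun t z => text (fun x y => x \ox (y \ox z)) t).

(* (b (x) b')(c (x) c') = bc (x) b'c', without sign: see [tmulE]. *)
Definition tmul (B : lmodType K) (mu : tens B B -> B) (s t : tens B B) :
    tens B B :=
  text (fun b b' => text (fun c c' => mu (b \ox c) \ox mu (b' \ox c')) t) s.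

Lemma tmap_bilin (M M' N N' : lmodType K)
    (f : {linear M -> M'}) (g : {linear N -> N'}) :
  bilin (fun x y => f x \ox g y).
Proof.
have [Hl Hr] := tpure_bilin M' N'.
by split=> [y|x] a u v; rewrite linearP ?(Hl _) ?(Hr _).
Qed.

Lemma tmapE (M M' N N' : lmodType K)
    (f : {linear M -> M'}) (g : {linear N -> N'}) x y :
  tmap f g (x \ox y) = f x \ox g y.
Proof. exact/textE/tmap_bilin. Qed.

Lemma tassoc_bilin_in (M N P : lmodType K) z :
  bilin (fun (x : M) (y : N) => x \ox (y \ox z) : tens M (tens N P)).
Proof.
have [Hl Hr] := tpure_bilin M (tens N P); have [Hl' Hr'] := tpure_bilin N P.
by split=> [y|x] a u v; rewrite ?(Hl _) // (Hl' _) (Hr _).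
Qed.

Lemma tassoc_bilin (M N P : lmodType K) :
  bilin (fun (t : tens M N) (z : P) =>
           text (fun x y => x \ox (y \ox z)) t : tens M (tens N P)).
Proof.
have [Hl Hr] := tpure_bilin M (tens N P); have [Hl' Hr'] := tpure_bilin N P.
split=> [z|t] a u v; first exact/text_linear/tassoc_bilin_in.
by apply: text_fun_linear => x y; rewrite (Hr' _) (Hr _).
Qed.

Lemma tassocE (M N P : lmodType K) (x : M) (y : N) (z : P) :
  tassoc ((x \ox y) \ox z) = x \ox (y \ox z).
Proof.
rewrite /tassoc (textE (@tassoc_bilin _ _ _)).
by rewrite (textE (@tassoc_bilin_in _ _ _ _)).
Qed.

Lemma tmulE (B : lmodType K) (mu : {linear tens B B -> B}) b b' c c' :
  tmul mu (b \ox b') (c \ox c') = mu (b \ox c) \ox mu (b' \ox c').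
Proof.
have [Hl Hr] := tpure_bilin B B.
rewrite /tmul textE ?textE //.
- by split=> [y|x] a u v; rewrite (Hr _) linearP ?(Hl _) ?(Hr _).
- by split=> [y|x] a u v; apply: text_fun_linear => z t;
    rewrite (Hl _) linearP ?(Hl _) ?(Hr _).
Qed.

End TensorMaps.

Section DirectSum.
Variables (K : pzRingType) (A : nat -> lmodType K).

Record dsum : Type := DSum {
  dcomp :> forall n, A n;
  dsum_finite : exists N, forall n, (N <= n)%N -> dcomp n = 0 }.

HB.instance Definition _ := gen_eqMixin dsum.
HB.instance Definition _ := gen_choiceMixin dsum.

Lemma dsumP (f g : dsum) : (forall n, f n = g n) -> f = g.
Proof.
case: f g => [f Hf] [g Hg] /= E.
have {}E : f = g by exact: functional_extensionality_dep.
by case: _ / E Hg => Hg; congr DSum; exact: Prop_irrelevance.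
Qed.

Lemma dzero_finite : exists N, forall n, (N <= n)%N -> (0 : A n) = 0.
Proof. by exists 0%N. Qed.

Lemma dadd_finite (f g : dsum) :
  exists N, forall n, (N <= n)%N -> f n + g n = 0.
Proof.
have [N HN] := dsum_finite f; have [N' HN'] := dsum_finite g.
by exists (maxn N N') => n; rewrite geq_max => /andP[/HN-> /HN'->]; rewrite addr0.
Qed.

Lemma dopp_finite (f : dsum) : exists N, forall n, (N <= n)%N -> - f n = 0.
Proof. by have [N HN] := dsum_finite f; exists N => n /HN->; rewrite oppr0. Qed.

Lemma dscale_finite a (f : dsum) :
  exists N, forall n, (N <= n)%N -> a *: f n = 0.
Proof. by have [N HN] := dsum_finite f; exists N => n /HN->; rewrite scaler0. Qed.

Definition dzero := DSum dzero_finite.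
Definition dadd f g := DSum (dadd_finite f g).
Definition dopp f := DSum (dopp_finite f).
Definition dscale a f := DSum (dscale_finite a f).

Lemma daddA : associative dadd.
Proof. by move=> *; apply: dsumP => n /=; rewrite addrA. Qed.
Lemma daddC : commutative dadd.
Proof. by move=> *; apply: dsumP => n /=; rewrite addrC. Qed.
Lemma dadd0 : left_id dzero dadd.
Proof. by move=> *; apply: dsumP => n /=; rewrite add0r. Qed.
Lemma daddN : left_inverse dzero dopp dadd.
Proof. by move=> *; apply: dsumP => n /=; rewrite addNr. Qed.

HB.instance Definition _ := GRing.isZmodule.Build dsum daddA daddC dadd0 daddN.

Lemma dscaleA a b f : dscale a (dscale b f) = dscale (a * b) f.
Proof. by apply: dsumP => n /=; rewrite scalerA. Qed.
Lemma dscale1 : left_id 1 dscale.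
Proof. by move=> *; apply: dsumP => n /=; rewrite scale1r. Qed.
Lemma dscaleDr : right_distributive dscale +%R.
Proof. by move=> *; apply: dsumP => n /=; rewrite scalerDr. Qed.
Lemma dscaleDl f : {morph dscale^~ f : a b / a + b}.
Proof. by move=> *; apply: dsumP => n /=; rewrite scalerDl. Qed.

HB.instance Definition _ := GRing.Zmodule_isLmodule.Build K dsum
  dscaleA dscale1 dscaleDr dscaleDl.

Lemma dinj_finite n (x : A n) :
  exists N, forall m, (N <= m)%N -> dfwith (fun k => 0 : A k) x m = 0.
Proof.
by exists n.+1 => m lt_nm; rewrite dfwith_out // neq_ltn lt_nm.
Qed.

Definition dinj n (x : A n) : dsum := DSum (dinj_finite x).

Lemma dinj_linear n : linear (@dinj n).
Proof.
move=> a x y; apply: dsumP => m /=; rewrite /dfwith.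
by case: eqP => [nm|_]; [case: _ / nm | rewrite scaler0 addr0].
Qed.

HB.instance Definition _ n :=
  GRing.isLinear.Build K (A n) dsum *:%R (@dinj n) (@dinj_linear n).

Definition dbound (f : dsum) : nat := sval (cid (dsum_finite f)).

(* The common extension of the maps [g n], meaningful when they are linear:
   see [dextE] and [dext_linear]. *)
Definition dext (W : lmodType K) (g : forall n, A n -> W) (f : dsum) : W :=
  \sum_(n < dbound f) g n (f n).

Section Ext.
Variables (W : lmodType K) (g : forall n, A n -> W).
Arguments g {n}.
Hypothesis Hg : forall n, linear (@g n).

Lemma dext_bound (f : dsum) N : (forall n, (N <= n)%N -> f n = 0) ->
  dext (@g) f = \sum_(n < N) g (f n).
Proof.
have g0 n : g (0 : A n) = 0 by exact: linear0 (linof (@Hg n)).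
have E a b (ab : (a <= b)%N) : (forall n, (a <= n)%N -> f n = 0) ->
    \sum_(n < b) g (f n) = \sum_(n < a) g (f n).
  move=> Ha; rewrite (big_ord_widen_cond _ xpredT (fun n => g (f n)) ab) /=.
  rewrite [RHS]big_mkcond /=; apply: eq_bigr => i _.
  by case: ltnP => // /Ha ->.
have HB := svalP (cid (dsum_finite f)) => HN.
rewrite /dext -/(dbound f) in HB *.
by case: (leqP N (dbound f)) => [|/ltnW] le; [rewrite (E _ _ le) | rewrite -(E _ _ le)].
Qed.

Lemma dext_linear : linear (dext (@g)).
Proof.
move=> a f h.
have [N HN] := dsum_finite f; have [N' HN'] := dsum_finite h.
have Hf n : (maxn N N' <= n)%N -> f n = 0.
  by rewrite geq_max => /andP[/HN].
have Hh n : (maxn N N' <= n)%N -> h n = 0.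
  by rewrite geq_max => /andP[_ /HN'].
have Hs n : (maxn N N' <= n)%N -> (a *: f + h) n = 0.
  by move=> le /=; rewrite Hf // Hh // scaler0 addr0.
rewrite (dext_bound Hs) (dext_bound Hf) (dext_bound Hh) scaler_sumr -big_split.
by apply: eq_bigr => i _; apply: Hg.
Qed.

Lemma dextE n (x : A n) : dext (@g) (dinj x) = g x.
Proof.
have g0 k : g (0 : A k) = 0 by exact: linear0 (linof (@Hg k)).
have Hb m : (n.+1 <= m)%N -> dinj x m = 0.
  by move=> lt_nm; rewrite /= dfwith_out // neq_ltn lt_nm.
rewrite (dext_bound Hb) big_ord_recr /= dfwith_in big1 ?add0r // => i _.
by rewrite dfwith_out ?g0 // neq_ltn ltn_ord orbT.
Qed.

End Ext.

Lemma dext_fun_linear (W : lmodType K) (g h k : forall n, A n -> W) a :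
  (forall n x, g n x = a *: h n x + k n x) ->
  forall f, dext g f = a *: dext h f + dext k f.
Proof.
by move=> E f; rewrite /dext scaler_sumr -big_split; apply: eq_bigr => i _.
Qed.

Lemma dsum_decomp (f : dsum) :
  exists N, f = \sum_(n < N) dinj (f n).
Proof.
have [N HN] := dsum_finite f; exists N; apply: dsumP => m.
have DE (s : seq 'I_N) :
    (\sum_(n <- s) dinj (f n)) m = \sum_(n <- s) dinj (f n) m.
  by elim: s => [|i s IH]; rewrite ?big_nil // !big_cons /= IH.
rewrite DE; case: (ltnP m N) => [lt|ge].
  rewrite (bigD1 (Ordinal lt)) //= dfwith_in big1 ?addr0 // => i ne.
  by rewrite dfwith_out //; apply: contraNneq ne => e; apply/eqP/val_inj.
rewrite HN // big1 // => i _ /=; rewrite dfwith_out //.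
by rewrite neq_ltn (leq_trans (ltn_ord i) ge).
Qed.

End DirectSum.

Section Bialgebra.
Variable K : comPzRingType.

Record bialgebra (B : lmodType K)
    (mu : {linear tens B B -> B}) (eta : {linear K^o -> B})
    (Delta : {linear B -> tens B B}) (eps : {linear B -> K^o}) : Prop :=
  Bialgebra {
    bialg_mulA : forall x y z : B, mu (x \ox mu (y \ox z)) = mu (mu (x \ox y) \ox z);
    bialg_mul1l : forall x : B, mu (eta 1 \ox x) = x;
    bialg_mul1r : forall x : B, mu (x \ox eta 1) = x;
    bialg_coassoc : forall x : B,
      tmap idfun Delta (Delta x) = tassoc (tmap Delta idfun (Delta x));
    bialg_counitl : forall x : B,
      text (fun (k : K^o) (y : B) => (k : K) *: y) (tmap eps idfun (Delta x)) = x;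
    bialg_counitr : forall x : B,
      text (fun (y : B) (k : K^o) => (k : K) *: y) (tmap idfun eps (Delta x)) = x;
    bialg_copM : forall x y : B, Delta (mu (x \ox y)) = tmul mu (Delta x) (Delta y);
    bialg_cop1 : Delta (eta 1) = eta 1 \ox eta 1;
    bialg_counitM : forall x y : B, eps (mu (x \ox y)) = eps x * eps y;
    bialg_counit1 : eps (eta 1) = 1 }.

Variable A : nat -> lmodType K.

Definition homog (n : nat) (z : dsum A) : Prop := exists x : A n, z = dinj x.

(* [z] lies in the sum over p <= n of the A_p (x) A_(n-p). *)
Definition homog2 (n : nat) (z : tens (dsum A) (dsum A)) : Prop :=
  exists w : forall p : 'I_n.+1, tens (A p) (A (n - p)),
    z = \sum_(p < n.+1) tmap (@dinj K A p) (@dinj K A (n - p)) (w p).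

Record graded_bialgebra
    (mu : {linear tens (dsum A) (dsum A) -> dsum A})
    (eta : {linear K^o -> dsum A})
    (Delta : {linear dsum A -> tens (dsum A) (dsum A)})
    (eps : {linear dsum A -> K^o}) : Prop :=
  GradedBialgebra {
    grbialg_bialg : bialgebra mu eta Delta eps;
    grbialg_mul : forall m n (x : A m) (y : A n),
      homog (m + n) (mu (dinj x \ox dinj y));
    grbialg_unit : forall k : K^o, homog 0 (eta k);
    grbialg_cop : forall n (x : A n), homog2 n (Delta (dinj x));
    grbialg_counit : forall n (x : A n), n <> 0%N -> eps (dinj x) = 0 }.

End Bialgebra.

Section TensorPower.
Variables (K : comPzRingType) (V : lmodType K) (n : nat).

Definition upd (v : {ffun 'I_n -> V}) (i : 'I_n) (x : V) : {ffun 'I_n -> V} :=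
  [ffun j => if j == i then x else v j].

Definition multilin (W : lmodType K) (f : {ffun 'I_n -> V} -> W) : Prop :=
  forall v i, linear (fun x => f (upd v i x)).

Inductive tpow_rel :
    pexpr K {ffun 'I_n -> V} -> pexpr K {ffun 'I_n -> V} -> Prop :=
  | tpow_rel_lin v i a x y : tpow_rel (PGen K (upd v i (a *: x + y)))
      (PAdd (PScale a (PGen K (upd v i x))) (PGen K (upd v i y))).

Definition tpow : lmodType K := presented tpow_rel.

Definition tppure (v : {ffun 'I_n -> V}) : tpow := pgen tpow_rel v.

Definition tpext (W : lmodType K) (f : {ffun 'I_n -> V} -> W) : tpow -> W :=
  @pext K _ tpow_rel W f.

Lemma tppure_multilin : multilin tppure.
Proof.
have [_ D _ S] := ppiE tpow_rel.
by move=> v i a x y; rewrite /tppure /pgen -S -D; apply/ppiP/peqv_rel.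
Qed.

Section Ext.
Variables (W : lmodType K) (f : {ffun 'I_n -> V} -> W).
Hypothesis Hf : multilin f.

Lemma tpext_rel e e' : tpow_rel e e' -> peval f e = peval f e'.
Proof. by case=> v i a x y /=; apply: Hf. Qed.

Lemma tpextE v : tpext f (tppure v) = f v.
Proof. exact: (pextE tpext_rel). Qed.

Lemma tpext_linear : linear (tpext f).
Proof. exact: (pext_linear tpext_rel). Qed.

End Ext.
End TensorPower.

(** [fingroup] composes permutations from left to right: the product
    pi sigma of the symmetric group, i |-> pi (sigma i), is [(sigma * pi)%g].
    Letters and positions are numbered from 0. *)

Definition Xset (n : nat) (c : seq nat) : {set 'S_n} :=
  [set s : 'S_n | [forall i : 'I_(size c), forall a : 'I_n, forall b : 'I_n,
     [&& sumn (take i c) <= a, a < b & b < sumn (take i.+1 c)]%N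
     ==> (s a < s b)%N]].

Section SProd.
Variables (n m : nat) (s : 'S_n) (s' : 'S_m).

Definition sprod_fun (i : 'I_(n + m)) : 'I_(n + m) :=
  match split i with
  | inl j => lshift m (s j)
  | inr k => rshift n (s' k)
  end.

Lemma sprod_inj : injective sprod_fun.
Proof.
move=> i j; rewrite /sprod_fun.
case: (splitP i) => a Ha; case: (splitP j) => b Hb /(congr1 val) /= E;
  apply: val_inj => /=; rewrite Ha Hb.
- by congr nat_of_ord; apply/(@perm_inj _ s)/val_inj.
- by have := ltn_ord (s a); rewrite E ltnNge leq_addr.
- by have := ltn_ord (s b); rewrite -E ltnNge leq_addr.
- by move/addnI: E => E; congr (n + nat_of_ord _)%N;
    apply/(@perm_inj _ s')/val_inj.
Qed.

Definition sprod : 'S_(n + m) := perm sprod_inj.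

End SProd.

Section Std.
Variables (d : Order.disp_t) (T : orderType d) (m : nat) (w : 'I_m -> T).

(* The letter in position [j] is numbered before the one in position [i]. *)
Definition std_before (j i : 'I_m) : bool :=
  (w j < w i)%O || (w j == w i) && (j < i)%N.

Lemma std_before_irr i : std_before i i = false.
Proof. by rewrite /std_before ltxx ltnn andbF. Qed.

Lemma std_before_trans : transitive std_before.
Proof.
move=> j i k; rewrite /std_before.
case/orP=> [ij|/andP[/eqP-> ij]]; case/orP=> [jk|/andP[/eqP<- jk]].
- by rewrite (lt_trans ij jk).
- by rewrite ij.
- by rewrite jk.
- by rewrite eqxx (ltn_trans ij jk) orbT.
Qed.

Lemma std_before_total i j : i != j -> std_before i j || std_before j i.
Proof.
rewrite /std_before -val_eqE neq_ltn.
by case: (ltgtP (w i) (w j)).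
Qed.

Lemma std_rank_lt i : (#|[set j | std_before j i]| < m)%N.
Proof.
rewrite -[ltnRHS]card_ord; apply/proper_card/properP; split.
  exact/subset_predT.
by exists i => //; rewrite inE std_before_irr.
Qed.

Definition std_fun (i : 'I_m) : 'I_m := Ordinal (std_rank_lt i).

Lemma std_inj : injective std_fun.
Proof.
have lt i j : std_before i j -> (std_fun i < std_fun j)%N.
  move=> ij; apply/proper_card/properP; split.
    by apply/subsetP=> k; rewrite !inE => /std_before_trans; apply.
  by exists i; rewrite inE ?std_before_irr.
move=> i j E; apply/eqP/negPn/negP => /std_before_total /orP[] /lt;
  by rewrite E ltnn.
Qed.

Definition std : 'S_m := perm std_inj.

End Std.

Definition wtake (T : Type) (n : nat) (p : 'I_n.+1) (w : 'I_n -> T) : 'I_p -> T :=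
  fun i => w (widen_ord (ltn_ord p : (p <= n)%N) i).

Definition wdrop (T : Type) (n : nat) (p : 'I_n.+1) (w : 'I_n -> T) :
    'I_(n - p) -> T :=
  fun i => w (cast_ord (subnKC (ltn_ord p : (p <= n)%N)) (rshift p i)).

Arguments wtake [T n] p w i.
Arguments wdrop [T n] p w i.

(* [s^-1 : 'S_n] is read as the word s^-1(0) ... s^-1(n-1) over 'I_n; the inverse
   of its standardized prefix (suffix) has the type 'S_p ('S_(n - p)). *)
Definition pileft (n : nat) (s : 'S_n) (p : 'I_n.+1) : 'S_p :=
  (std (wtake p (s^-1)%g))^-1%g.

Definition piright (n : nat) (s : 'S_n) (p : 'I_n.+1) : 'S_(n - p) :=
  (std (wdrop p (s^-1)%g))^-1%g.

Section FV.
Variables (K : comPzRingType) (V : lmodType K).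

Definition grpalg (n : nat) : lmodType K := {ffun 'S_n -> K^o}.

Definition gdelta (n : nat) (s : 'S_n) : grpalg n := [ffun t => (t == s)%:R].

Definition xelt (n : nat) (c : seq nat) : grpalg n :=
  \sum_(s in Xset n c) gdelta s.

Definition F (n : nat) : lmodType K := tens (tpow V n) (grpalg n).

Definition fpure (n : nat) (v : {ffun 'I_n -> V}) (s : 'S_n) : F n :=
  tppure v \ox gdelta s.

Local Notation "v # s" := (fpure v s) (at level 40).

(* The linear map on [F n] sending v # s to [g s v], meaningful when each
   [g s] is multilinear: see [fextE] and [fext_linear]. *)
Definition fext (n : nat) (W : lmodType K) (g : 'S_n -> {ffun 'I_n -> V} -> W) :
    F n -> W :=
  text (fun (t : tpow V n) (a : {ffun 'S_n -> K^o}) =>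
          \sum_s (a s : K) *: tpext (g s) t).

Lemma grpalg_sum n (a : {ffun 'S_n -> K^o}) :
  a = \sum_s (a s : K) *: gdelta s :> grpalg n.
Proof.
apply/ffunP => t; rewrite sum_ffunE (bigD1 t) //= big1 => [|s ne];
  rewrite !ffunE ?eqxx ?addr0 -?[RHS]/(_ * _) ?mulr1 //.
by rewrite eq_sym (negPf ne) -[LHS]/(_ * _) mulr0.
Qed.

Section FExt.
Variables (n : nat) (W : lmodType K) (g : 'S_n -> {ffun 'I_n -> V} -> W).
Hypothesis Hg : forall s, multilin (g s).

Lemma fext_bilin : bilin (fun (t : tpow V n) (a : {ffun 'S_n -> K^o}) =>
  \sum_s (a s : K) *: tpext (g s) t).
Proof.
split=> [a|t] k u v; rewrite scaler_sumr -big_split; apply: eq_bigr => s _.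
  by rewrite (tpext_linear (Hg s)) scalerDr !scalerA mulrC.
by rewrite !ffunE scalerDl -scalerA.
Qed.

Lemma fextE v s : fext g (v # s) = g s v.
Proof.
rewrite /fext (textE fext_bilin) (bigD1 s) //= big1 => [|t ne].
  by rewrite ffunE eqxx scale1r addr0 (tpextE (Hg s)).
by rewrite ffunE (negPf ne) scale0r.
Qed.

Lemma fext_linear : linear (fext g).
Proof. exact: text_linear fext_bilin. Qed.

End FExt.

Lemma F_ind n (P : F n -> Prop) :
  (forall v s, P (v # s)) -> P 0 ->
  (forall a p q, P p -> P q -> P (a *: p + q)) -> forall p, P p.
Proof.
move=> Pg P0 PL; have [Hl Hr] := tpure_bilin (tpow V n) (grpalg n).
apply: tens_ind => // t a; elim/pres_ind: t => [v||k p q Hp Hq].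
- rewrite (grpalg_sum a); elim/big_rec: _ => [|s b _ Hb].
    by rewrite [_ \ox _](linear0 (linof (Hr _))).
  by rewrite (Hr _); apply: PL; first exact: Pg.
- by rewrite [_ \ox _](linear0 (linof (Hl _))).
- by rewrite (Hl _); exact: PL.
Qed.

Lemma fext_fun_linear n (W : lmodType K)
    (f g h : 'S_n -> {ffun 'I_n -> V} -> W) a :
  (forall s v, f s v = a *: g s v + h s v) ->
  forall p, fext f p = a *: fext g p + fext h p.
Proof.
move=> E; apply: text_fun_linear => t b.
rewrite scaler_sumr -big_split; apply: eq_bigr => s _.
rewrite /tpext (pext_fun_linear (E s)) scalerDr !scalerA mulrC.
by [].
Qed.

(* [vperm q v] is v_{q^-1(1)} ... v_{q^-1(n)}, and [gact] is the left action
   of the group algebra: see [gactE]. *)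
Definition vperm (n : nat) (q : 'S_n) (v : {ffun 'I_n -> V}) :
    {ffun 'I_n -> V} := [ffun i => v (q^-1%g i)].

Definition gact (n : nat) (a : {ffun 'S_n -> K^o}) (p : F n) : F n :=
  \sum_q (a q : K) *: fext (fun s v => vperm q v # (s * q)%g) p.

Lemma vperm_upd n (q : 'S_n) v i x : vperm q (upd v i x) = upd (vperm q v) (q i) x.
Proof.
by apply/ffunP => j; rewrite !ffunE -(inj_eq (@perm_inj _ q)) permKV.
Qed.

Lemma fpure_multilin n (s : 'S_n) : multilin (fun v => v # s).
Proof.
move=> v i a x y; rewrite /fpure tppure_multilin.
exact: (tpure_bilin _ _).1.
Qed.

Lemma gact_multilin n (q : 'S_n) s :
  multilin (fun v => vperm q v # (s * q)%g).
Proof. by move=> v i a x y; rewrite !vperm_upd; exact: fpure_multilin. Qed.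

Lemma gactE n (q : 'S_n) v s : gact (gdelta q) (v # s) = vperm q v # (s * q)%g.
Proof.
rewrite /gact (bigD1 q) //= big1 => [|t ne]; rewrite ffunE.
  by rewrite eqxx scale1r addr0 (fextE (gact_multilin q)).
by rewrite (negPf ne) scale0r.
Qed.

Lemma gact_bilin n : bilin (@gact n).
Proof.
split=> [p|b] k u v; rewrite scaler_sumr -big_split; apply: eq_bigr => q _.
  by rewrite !ffunE scalerDl -scalerA.
by rewrite (fext_linear (gact_multilin q)) scalerDr !scalerA mulrC.
Qed.

Definition vcat (n m : nat) (v : {ffun 'I_n -> V}) (v' : {ffun 'I_m -> V}) :
    {ffun 'I_(n + m) -> V} :=
  [ffun i => match split i with inl j => v j | inr k => v' k end].

Lemma vcat_updl n m (v : {ffun 'I_n -> V}) (v' : {ffun 'I_m -> V}) i x :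
  vcat (upd v i x) v' = upd (vcat v v') (lshift m i) x.
Proof.
apply/ffunP => j; rewrite !ffunE -val_eqE /=.
case: (splitP j) => k E; rewrite E ?ffunE -?val_eqE //.
by rewrite gtn_eqF // ltn_addr.
Qed.

Lemma vcat_updr n m (v : {ffun 'I_n -> V}) (v' : {ffun 'I_m -> V}) i x :
  vcat v (upd v' i x) = upd (vcat v v') (rshift n i) x.
Proof.
apply/ffunP => j; rewrite !ffunE -val_eqE /=.
case: (splitP j) => k E; rewrite E ?ffunE -?val_eqE /= ?eqn_add2l //.
by rewrite ltn_eqF // ltn_addr.
Qed.

(* The external product; [fmulhE] gives its values on generators. *)
Definition fmulh (n m : nat) (p : F n) (q : F m) : F (n + m) :=
  fext (fun s v => fext (fun s' v' =>
    gact (xelt (n + m) [:: n; m]) (vcat v v' # sprod s s')) q) p.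

Lemma fmulh_multilinr n m s (v : {ffun 'I_n -> V}) (s' : 'S_m) :
  multilin (fun v' =>
    gact (xelt (n + m) [:: n; m]) (vcat v v' # sprod s s')).
Proof.
move=> v' i a x y; rewrite !vcat_updr fpure_multilin.
exact: (gact_bilin _).2.
Qed.

Lemma fmulh_multilinl n m (s : 'S_n) (q : F m) :
  multilin (fun v => fext (fun s' v' =>
    gact (xelt (n + m) [:: n; m]) (vcat v v' # sprod s s')) q).
Proof.
move=> v i a x y; apply: fext_fun_linear => s' v'.
rewrite !vcat_updl fpure_multilin; exact: (gact_bilin _).2.
Qed.

Lemma fmulhE n m v s v' s' : @fmulh n m (v # s) (v' # s') =
  gact (xelt (n + m) [:: n; m]) (vcat v v' # sprod s s').
Proof.
by rewrite /fmulh (fextE (fun s => fmulh_multilinl s _))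
  (fextE (fmulh_multilinr _ _)).
Qed.

Lemma fmulh_bilin n m : bilin (@fmulh n m).
Proof.
split=> [q|p] a x y; first exact: (fext_linear (fun s => fmulh_multilinl s q)).
by apply: fext_fun_linear => s v; exact: (fext_linear (fmulh_multilinr s v)).
Qed.

Definition fmul_fun : tens (dsum F) (dsum F) -> dsum F :=
  text (fun a b => dext (fun n p => dext (fun m q => dinj (fmulh p q)) b) a).

Lemma fmul_linearr n (p : F n) :
  forall m, linear (fun q : F m => dinj (fmulh p q) : dsum F).
Proof. by move=> m k x y; rewrite (fmulh_bilin _ _).2 linearP. Qed.

Lemma fmul_linearl (b : dsum F) :
  forall n, linear (fun p : F n =>
    dext (fun m q => dinj (fmulh p q)) b : dsum F).
Proof.
move=> n k x y; apply: dext_fun_linear => m q.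
by rewrite ((fmulh_bilin _ _).1 q) linearP.
Qed.

Lemma fmul_bilin : bilin (fun a b : dsum F =>
  dext (fun n p => dext (fun m q => dinj (fmulh p q)) b) a : dsum F).
Proof.
split=> [b|a] k x y; first exact: (dext_linear (@fmul_linearl b)).
by apply: dext_fun_linear => n p; exact: (dext_linear (@fmul_linearr n p)).
Qed.

Definition fmul : {linear tens (dsum F) (dsum F) -> dsum F} :=
  linof (text_linear fmul_bilin : linear fmul_fun).

Lemma fmulE n m (p : F n) (q : F m) :
  fmul (dinj p \ox dinj q) = dinj (fmulh p q).
Proof.
by rewrite [LHS](textE fmul_bilin) (dextE (@fmul_linearl _))
  (dextE (@fmul_linearr _ _)).
Qed.

(* The value of the coproduct at v # s, see [fcopE]. *)
Definition fcop_pure (n : nat) (s : 'S_n) (v : {ffun 'I_n -> V}) :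
    tens (dsum F) (dsum F) :=
  \sum_(p < n.+1) dinj (finfun (wtake p v) # pileft s p)
              \ox dinj (finfun (wdrop p v) # piright s p).

Definition fcop_fun : dsum F -> tens (dsum F) (dsum F) :=
  dext (fun n => fext (@fcop_pure n)).

Lemma wtake_upd n (p : 'I_n.+1) (v : {ffun 'I_n -> V}) i x :
  finfun (wtake p (upd v i x)) =
  (if insub (i : nat) is Some j then upd (finfun (wtake p v)) j x
   else finfun (wtake p v)).
Proof.
case: insubP => [j _ E|ge]; apply/ffunP => k; rewrite !ffunE /wtake !ffunE.
  by rewrite -!val_eqE /= E.
by case: eqP => // e; case/negP: ge; rewrite -e /=.
Qed.

Lemma wdrop_upd n (p : 'I_n.+1) (v : {ffun 'I_n -> V}) i x :
  finfun (wdrop p (upd v i x)) =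
  (if insub (i - p)%N is Some j then
     if (p <= i)%N then upd (finfun (wdrop p v)) j x else finfun (wdrop p v)
   else finfun (wdrop p v)).
Proof.
have H (k : 'I_(n - p)) :
    (cast_ord (subnKC (ltn_ord p : (p <= n)%N)) (rshift p k) == i)
    = (p <= i)%N && (k == i - p :> nat)%N.
  rewrite -val_eqE /=; case: leqP => [le|lt] /=.
    by rewrite -[RHS](eqn_add2l p) subnKC.
  by rewrite gtn_eqF // (leq_trans lt) // leq_addr.
case: insubP => [j _ E|ge]; last first.
  apply/ffunP => k; rewrite !ffunE /wdrop !ffunE H.
  by case: eqP => [e|]; rewrite ?andbF //; case/negP: ge; rewrite -e ltn_ord.
case: ifP => le; apply/ffunP => k; rewrite !ffunE /wdrop !ffunE H le //=.
by rewrite -val_eqE /= E.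
Qed.

Lemma fcop_multilin n (s : 'S_n) : multilin (fcop_pure s).
Proof.
have [Hl Hr] := tpure_bilin (dsum F) (dsum F).
move=> v i a x y; rewrite /fcop_pure scaler_sumr -big_split.
apply: eq_bigr => p _; rewrite !wtake_upd !wdrop_upd.
case: insubP => [j lt _|ge].
  have nle : (p <= i)%N = false by rewrite leqNgt lt.
  have wd z : (if insub (i - p)%N is Some j0 then
     if (p <= i)%N then upd (finfun (wdrop p v)) j0 z else finfun (wdrop p v)
     else finfun (wdrop p v)) = finfun (wdrop p v).
    by rewrite nle; case: insub.
  by rewrite !wd fpure_multilin linearP; exact: Hl.
rewrite -leqNgt in ge; case: insubP => [j _ _|].
  by rewrite ge fpure_multilin linearP; exact: Hr.
by rewrite -leqNgt leqNgt ltn_sub2r // (leq_ltn_trans ge).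
Qed.

Lemma fcop_linear n : linear (fext (@fcop_pure n)).
Proof. exact: fext_linear (@fcop_multilin n). Qed.

Definition fcop : {linear dsum F -> tens (dsum F) (dsum F)} :=
  linof (dext_linear fcop_linear : linear fcop_fun).

Lemma fcopE n (v : {ffun 'I_n -> V}) s : fcop (dinj (v # s)) = fcop_pure s v.
Proof. by rewrite [LHS](dextE fcop_linear) (fextE (@fcop_multilin n)). Qed.

(* The identification of K with [F 0]. *)
Definition F0_of (k : K^o) : F 0 := (k : K) *: ([ffun=> 0] # 1%g).

Definition F0_to : F 0 -> K^o := @fext 0 K^o (fun _ _ => 1).

Lemma F0_multilin (s : 'S_0) : multilin (fun _ : {ffun 'I_0 -> V} => 1 : K^o).
Proof. by move=> v []. Qed.

Lemma F0_of_linear : linear F0_of.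
Proof. by move=> a x y; rewrite /F0_of scalerDl -scalerA. Qed.

Lemma F0_to_linear : linear F0_to.
Proof. exact: fext_linear F0_multilin. Qed.

Lemma F0_ofK : cancel F0_of F0_to.
Proof.
move=> k; rewrite [LHS](linearZ_LR (linof F0_to_linear)) /= [F0_to _](fextE F0_multilin).
exact: mulr1.
Qed.

Lemma F0_toK : cancel F0_to F0_of.
Proof.
elim/F_ind => [v s||a p q Hp Hq].
- rewrite [F0_to _](fextE F0_multilin) /F0_of scale1r.
  by congr (_ # _); [apply/ffunP => -[] | apply/permP => -[]].
- have -> : F0_to 0 = 0 := linear0 (linof F0_to_linear).
  exact: linear0 (linof F0_of_linear).
- by rewrite F0_to_linear F0_of_linear Hp Hq.
Qed.

Definition funit_fun (k : K^o) : dsum F := dinj (F0_of k).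

Lemma funit_linear : linear funit_fun.
Proof. by move=> a x y; rewrite /funit_fun F0_of_linear linearP. Qed.

Definition funit : {linear K^o -> dsum F} := linof funit_linear.

Definition fcounit_fun (f : dsum F) : K^o := F0_to (f 0%N).

Lemma fcounit_linear : linear fcounit_fun.
Proof. by move=> a x y; rewrite -F0_to_linear. Qed.

Definition fcounit : {linear dsum F -> K^o} := linof fcounit_linear.

End FV.

(* Main.v *)
Require Import Defs.
From mathcomp Require Import all_boot all_algebra.
From mathcomp Require Import all_order all_fingroup.

(** The generator v # s is encoded by the word whose i-th letter is the pair
    (v_i, s^-1(i)), numbers being relevant only up to standardization. In these
    terms [Delta] is deconcatenation, and the product of two words with distinct
    numbers, those of the first all smaller than those of the second, is the sum
    of their shuffles: X_(n,m) consists of the inverses of the shuffles of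
    0 ... n-1 and n ... n+m-1. As the numbers of a word may be shifted, the
    bialgebra axioms on generators reduce to the associativity of the shuffle
    of words and its compatibility with deconcatenation. *)

Set Implicit Arguments.
Unset Strict Implicit.
Unset Printing Implicit Defensive.

Import Order.TTheory GRing.Theory.

Local Open Scope ring_scope.

(** * Shuffles and cuts of words *)

Section Shuffle.
Variable T : Type.
Implicit Types (a b : T) (u v w x : seq T).

(** The inner fixpoint serves the recursive calls that shorten only the second word. The result is a
    list and not a set, so that shuffles count with multiplicity. *)
Fixpoint shuffle u : seq T -> seq (seq T) :=
  if u is a :: u' then
    fix shuffle_u v := if v is b :: v' then
      map (cons a) (shuffle u' v) ++ map (cons b) (shuffle_u v') else [:: u]
  else fun v => [:: v].

Fixpoint splits x : seq (seq T * seq T) :=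
  if x is a :: x' then
    ([::], x) :: [seq (a :: p.1, p.2) | p <- splits x']
  else [:: ([::], [::])].

Arguments shuffle : simpl never.
Arguments splits : simpl never.

Lemma shuffle0s v : shuffle [::] v = [:: v].
Proof. by []. Qed.

Lemma shuffles0 u : shuffle u [::] = [:: u].
Proof. by case: u. Qed.

Lemma shuffle_cons a u b v :
  shuffle (a :: u) (b :: v) =
  map (cons a) (shuffle u (b :: v)) ++ map (cons b) (shuffle (a :: u) v).
Proof. by []. Qed.

Section Sums.
Variable M : nmodType.

Lemma splits_cons_sum a x (g : seq T -> seq T -> M) :
  \sum_(p <- splits (a :: x)) g p.1 p.2 =
  g [::] (a :: x) + \sum_(p <- splits x) g (a :: p.1) p.2.
Proof. by rewrite big_cons big_map. Qed.

(** Both sides run over the shuffles of three words. Sorting these by their first letter, which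
    comes from [u], [v] or [w], leaves one induction hypothesis per case; [f] is arbitrary so that
    it can absorb this letter. *)
Lemma shuffleA_sum u v w (f : seq T -> M) :
  \sum_(x <- shuffle v w) \sum_(y <- shuffle u x) f y =
  \sum_(x <- shuffle u v) \sum_(y <- shuffle x w) f y.
Proof.
elim: u v w f => [|a u IHu] v w f.
  by rewrite shuffle0s big_seq1; under eq_bigr do rewrite shuffle0s big_seq1.
elim: v w f => [|b v IHv] w f.
  by rewrite shuffle0s shuffles0 !big_seq1.
elim: w f => [|c w IHw] f.
  by rewrite !shuffles0 big_seq1; under [RHS]eq_bigr do rewrite shuffles0 big_seq1.
rewrite !shuffle_cons !big_cat !big_map /=.
under eq_bigr do rewrite shuffle_cons big_cat !big_map /=.
under [X in _ + X]eq_bigr do rewrite shuffle_cons big_cat !big_map /=.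
under [X in _ = X + _]eq_bigr do rewrite shuffle_cons big_cat !big_map /=.
under [X in _ = _ + X]eq_bigr do rewrite shuffle_cons big_cat !big_map /=.
rewrite !big_split /= addrACA [RHS]addrACA.
(* The terms starting with [a] come in two groups, which together again run over all shuffles of
   [b :: v] and [c :: w]. *)
have -> : \sum_(x <- shuffle v (c :: w)) \sum_(y <- shuffle u (b :: x)) f (a :: y) +
    \sum_(x <- shuffle (b :: v) w) \sum_(y <- shuffle u (c :: x)) f (a :: y) =
    \sum_(x <- shuffle (b :: v) (c :: w)) \sum_(y <- shuffle u x) f (a :: y).
  by rewrite shuffle_cons big_cat !big_map.
rewrite (IHu _ _ (fun y => f (a :: y))) (IHv _ (fun y => f (b :: y))).
rewrite (IHw (fun y => f (c :: y))) shuffle_cons big_cat !big_map /=.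
by rewrite -!addrA; congr (_ + _); rewrite addrCA.
Qed.

(** Cutting a shuffle cuts each of the two words, and the halves are then shuffled separately. In
    the induction, a cut either has an empty first half or a first half starting with [a] or [b]. *)
Lemma splits_shuffle_sum u v (g : seq T -> seq T -> M) :
  \sum_(x <- shuffle u v) \sum_(p <- splits x) g p.1 p.2 =
  \sum_(p <- splits u) \sum_(q <- splits v)
    \sum_(y <- shuffle p.1 q.1) \sum_(z <- shuffle p.2 q.2) g y z.
Proof.
elim: u v g => [|a u IHu] v g.
  by rewrite shuffle0s !big_seq1; under [RHS]eq_bigr do rewrite !shuffle0s !big_seq1.
elim: v g => [|b v IHv] g.
  by rewrite shuffles0 big_seq1; under [RHS]eq_bigr do rewrite big_seq1 !shuffles0 !big_seq1.
rewrite [in LHS]shuffle_cons big_cat !big_map [LHS]/=.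
under eq_bigr do rewrite splits_cons_sum.
under [X in _ + X]eq_bigr do rewrite splits_cons_sum.
rewrite !big_split /= addrACA.
rewrite (IHu (b :: v) (fun y => g (a :: y))) (IHv (fun y => g (b :: y))).
pose S y z := \sum_(x <- shuffle y.1 z.1) \sum_(x' <- shuffle y.2 z.2) g x x'.
rewrite (splits_cons_sum a u (fun y y' => \sum_(q <- splits (b :: v)) S (y, y') q)).
rewrite (splits_cons_sum b v (fun z z' => S ([::], a :: u) (z, z'))).
under [X in _ = _ + X]eq_bigr => p _.
  rewrite (splits_cons_sum b v (fun z z' => S (a :: p.1, p.2) (z, z'))).
over.
rewrite big_split /= -[RHS]addrA; congr (_ + _).
(* These are the cuts with an empty first half. *)
- by rewrite /S shuffle0s big_seq1 shuffle_cons big_cat !big_map.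
rewrite (splits_cons_sum a u (fun y y' => \sum_(q <- splits v)
  \sum_(x <- shuffle y q.1) \sum_(x' <- shuffle y' q.2) g (b :: x) x')).
(* The first group has first halves made of letters of [b :: v] alone; the others use a prefix of
   [a :: u] starting with [a] and are compared for each cut [p] of [u]. *)
rewrite addrCA; congr (_ + _).
  by apply: eq_bigr => q _; rewrite /S /= !shuffle0s !big_seq1.
rewrite -!big_split; apply: eq_bigr => p _ /=.
rewrite (splits_cons_sum b v (fun z z' =>
  \sum_(x <- shuffle p.1 z) \sum_(x' <- shuffle p.2 z') g (a :: x) x')).
rewrite -addrA -big_split /S /= !shuffles0 !big_seq1; congr (_ + _).
by apply: eq_bigr => q _; rewrite shuffle_cons big_cat !big_map.
Qed.

(** Both sides run over the cuts of [u] into three factors. *)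
Lemma splitsA_sum u (h : seq T -> seq T -> seq T -> M) :
  \sum_(p <- splits u) \sum_(r <- splits p.2) h p.1 r.1 r.2 =
  \sum_(p <- splits u) \sum_(r <- splits p.1) h r.1 r.2 p.2.
Proof.
elim: u h => [|a u IHu] h; first by rewrite !big_seq1.
rewrite (splits_cons_sum a u (fun y y' => \sum_(r <- splits y') h y r.1 r.2)).
rewrite (splits_cons_sum a u (fun y y' => \sum_(r <- splits y) h r.1 r.2 y')).
rewrite (splits_cons_sum a u (h [::])) big_seq1 -addrA; congr (_ + _).
rewrite (IHu (fun y => h (a :: y))) -big_split; apply: eq_bigr => p _.
by rewrite (splits_cons_sum a p.1 (fun y y' => h y y' p.2)).
Qed.

End Sums.

(** Makes the place of the cut explicit, since the coproduct is indexed by it. *)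
Lemma splitsE x :
  splits x = [seq (take i x, drop i x) | i <- iota 0 (size x).+1].
Proof.
elim: x => // a x IH; rewrite {1}/splits -/(splits x) IH /=; congr (_ :: _).
by rewrite -(addn1 1) iotaDl -!map_comp.
Qed.

End Shuffle.

(** * Recognizing shuffles by filtering *)

Section ShuffleMem.
Variable T : eqType.
Implicit Types (a b : T) (u v w x : seq T).

Lemma shuffle_perm u v x : x \in shuffle u v -> perm_eq x (u ++ v).
Proof.
elim: u v x => [|a u IHu] v x; first by rewrite inE => /eqP ->.
elim: v x => [|b v IHv] x; first by rewrite inE => /eqP ->; rewrite cats0.
rewrite shuffle_cons mem_cat => /orP[] /mapP[y Hy ->].
  by rewrite /= perm_cons IHu.
by rewrite perm_sym -[b :: v]cat1s perm_catCA perm_cons perm_sym IHv.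
Qed.

Section Filter.
Variable P : pred T.

(** With [shuffle_filter], this characterizes the shuffles of two words whose letters are told apart
    by [P]. *)
Lemma filter_shuffle x : x \in shuffle (filter P x) (filter (predC P) x).
Proof.
elim: x => //= a x; rewrite /predC /=; case: (P a) => /=.
  case: (filter (fun _ => ~~ _) x) => [|b v] IH.
    by move: IH; rewrite !shuffles0 !inE => /eqP <-.
  by rewrite mem_cat map_f.
case: (filter P x) => [|b u] IH; first by move: IH; rewrite !inE => /eqP <-.
by rewrite shuffle_cons mem_cat orbC map_f.
Qed.

Lemma shuffle_filter u v x : all P u -> all (predC P) v ->
  x \in shuffle u v -> (filter P x == u) && (filter (predC P) x == v).
Proof.
have N Q s : all (predC Q) s -> (filter Q s == [::]).
  by elim: s => //= a s IH /andP[/negPf -> /IH].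
elim: u v x => [|a u IHu] v x.
  by move=> _ Pv; rewrite inE => /eqP ->; rewrite N //= (all_filterP Pv).
elim: v x => [|b v IHv] x.
  move=> Pu _; rewrite inE => /eqP ->; rewrite (all_filterP Pu) eqxx N //.
  by apply: sub_all Pu => c; rewrite /= negbK.
move=> Pau Pbv; have /andP[Pa Pu] : P a && all P u := Pau.
have /andP[Pb Pv] : ~~ P b && all (predC P) v := Pbv.
rewrite shuffle_cons mem_cat => /orP[] /mapP[y Hy ->] /=.
  by rewrite Pa /= eqseq_cons eqxx; exact: IHu.
by rewrite (negPf Pb) /= eqseq_cons eqxx; exact: IHv.
Qed.

(** The two lists joined by [shuffle_cons] have words starting with different letters, as [P] holds
    for only one of them. *)
Lemma shuffle_uniq u v : all P u -> all (predC P) v -> uniq (shuffle u v).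
Proof.
elim: u v => [|a u IHu] // v; elim: v => [|b v IHv] //.
move=> Pau Pbv; have /andP[Pa Pu] : P a && all P u := Pau.
have /andP[Pb Pv] : ~~ P b && all (predC P) v := Pbv.
have cI (c : T) : injective (cons c) by move=> s s' [].
rewrite shuffle_cons cat_uniq !(map_inj_uniq (@cI _)).
rewrite IHu // IHv // andbT /=.
apply/hasPn => _ /mapP[y _ ->]; apply/mapP => -[z _ [ab]].
by move: Pb; rewrite ab Pa.
Qed.

End Filter.
End ShuffleMem.

Lemma shuffle_map (T U : Type) (h : T -> U) u v :
  shuffle (map h u) (map h v) = map (map h) (shuffle u v).
Proof.
elim: u v => [|a u IHu] v //; elim: v => [|b v IHv] //.
rewrite !map_cons !shuffle_cons map_cat -!map_comp -map_cons IHu.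
by rewrite -[h a :: _]map_cons IHv -!map_comp.
Qed.

Section Counit.
Variables (T : Type) (K : comPzRingType) (M : lmodType K).

Lemma splits_counitl (u : seq T) (f : seq T -> M) :
  \sum_(p <- splits u) (nilp p.1)%:R *: f p.2 = f u.
Proof.
case: u => [|a u]; first by rewrite big_seq1 scale1r.
rewrite (splits_cons_sum a u (fun y z => (nilp y)%:R *: f z)) scale1r.
by rewrite big1 ?addr0 // => p _; rewrite scale0r.
Qed.

Lemma splits_counitr (u : seq T) (f : seq T -> M) :
  \sum_(p <- splits u) (nilp p.2)%:R *: f p.1 = f u.
Proof.
elim: u f => [|a u IH] f; first by rewrite big_seq1 scale1r.
rewrite (splits_cons_sum a u (fun y z => (nilp z)%:R *: f y)) scale0r add0r.
exact: (IH (fun y => f (a :: y))).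
Qed.

Lemma shuffle_counit (u z : seq T) :
  \sum_(x <- shuffle u z) (nilp x)%:R = (nilp u)%:R * (nilp z)%:R :> K^o.
Proof.
case: u => [|a u]; first by rewrite shuffle0s big_seq1 mul1r.
case: z => [|b z]; first by rewrite shuffles0 big_seq1 mul0r.
by rewrite shuffle_cons big_cat !big_map /= mul0r !big1 ?addr0.
Qed.

End Counit.

(** * Linearity of bare functions and of tensor maps *)

Section Linear.
Variable K : comPzRingType.

(** With linearity as a hypothesis, this applies to partial applications of bilinear maps. *)
Lemma linear_sum_seq (W W' : lmodType K) (f : W -> W') (I : Type) (r : seq I)
    (g : I -> W) :
  linear f -> f (\sum_(i <- r) g i) = \sum_(i <- r) f (g i).
Proof. by move=> Hf; exact: (linear_sum (linof Hf)). Qed.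

Lemma linear_comp_fun (U W W' : lmodType K) (g : W -> W') (f : U -> W) :
  linear g -> linear f -> linear (fun t => g (f t)).
Proof. by move=> Hg Hf a p q; rewrite Hf Hg. Qed.

Lemma linear_of (U W : lmodType K) (f : {linear U -> W}) : linear f.
Proof. exact: linearP. Qed.

Lemma tmap_linear (M M' N N' : lmodType K)
    (f : {linear M -> M'}) (g : {linear N -> N'}) : linear (tmap f g).
Proof. exact/text_linear/tmap_bilin. Qed.

Lemma tmul_bilin (B : lmodType K) (mu : {linear tens B B -> B}) :
  bilin (tmul mu).
Proof.
have [Hl Hr] := tpure_bilin B B.
have Bi b b' : bilin (fun c c' => mu (b \ox c) \ox mu (b' \ox c')).
  by split=> [y|x] a r r'; rewrite (Hr _) linearP ?(Hl _) ?(Hr _).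
split=> [t|r].
  by apply: text_linear; split=> [y|x] a r r'; apply: text_fun_linear => z z';
    rewrite (Hl _) linearP ?(Hl _) ?(Hr _).
by move=> a t t'; apply: text_fun_linear => b b'; exact: text_linear.
Qed.

End Linear.

(** * Order properties that determine a standardization *)

Section Standardization.
Variables (d : Order.disp_t) (T : orderType d) (m : nat) (w : 'I_m -> T).

Lemma std_ltE i j : (std w i < std w j)%N = std_before w i j.
Proof.
have lt k l : std_before w k l -> (std w k < std w l)%N.
  move=> kl; rewrite !permE; apply/proper_card/properP; split.
    by apply/subsetP => x; rewrite !inE => /std_before_trans; apply.
  by exists k; rewrite inE ?std_before_irr.
apply/idP/idP => [ij|]; last exact: lt.
have ne : i != j.
  by apply: contraTneq ij => ->; rewrite ltnn.
have /orP[|/lt ji] := std_before_total w ne; first by [].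
by have := ltn_trans ij ji; rewrite ltnn.
Qed.

(** The rank of [i] counts the [j] with [t j < t i], and there are exactly [t i] of them. *)
Lemma std_unique (t : 'S_m) :
  (forall i j, (t i < t j)%N = std_before w i j) -> std w = t.
Proof.
move=> E; apply/permP => i; apply: val_inj; rewrite permE /=.
have -> : [set j | std_before w j i] = t @^-1: [set k : 'I_m | (k < t i)%N].
  by apply/setP => j; rewrite !inE E.
rewrite (card_preimset _ (@perm_inj _ t)) -sum1dep_card.
by rewrite -(big_ord_widen m (fun=> 1%N)) 1?ltnW // sum1_card card_ord.
Qed.

(** Standardizing first does not alter the order of the letters on a subword, ties included, because
    [f] preserves positions. Hence standardizing a factor of [std w] is standardizing that factor of
    [w]. *)
Lemma std_before_std k (f : 'I_k -> 'I_m) :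
  (forall i j, (f i < f j)%N = (i < j)%N) ->
  forall i j, std_before (fun x => std w (f x)) i j =
              std_before (fun k => w (f k)) i j.
Proof.
move=> Hf i j; rewrite /std_before ltEord /= std_ltE /std_before Hf.
case: (eqVneq (std w (f i)) (std w (f j))) => [/perm_inj E|_]; last by rewrite orbF.
by rewrite -Hf E ltnn !andbF orbF.
Qed.

End Standardization.

(** * Permutations as words, and the set X_(n,m) as inverse shuffles *)

Definition perm_word n (t : 'S_n) : seq nat := [seq val (t i) | i <- enum 'I_n].

Lemma size_perm_word n (t : 'S_n) : size (perm_word t) = n.
Proof. by rewrite size_map size_enum_ord. Qed.

Lemma nth_perm_word n (t : 'S_n) (i : 'I_n) : nth 0%N (perm_word t) i = t i.
Proof. by rewrite (nth_map i) ?nth_ord_enum // size_enum_ord. Qed.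

Lemma perm_word_iota n (t : 'S_n) : perm_eq (perm_word t) (iota 0 n).
Proof.
rewrite -val_enum_ord /perm_word (map_comp val t); apply: perm_map.
apply: uniq_perm => [||i]; rewrite ?(map_inj_uniq (@perm_inj _ _)) ?enum_uniq //.
by rewrite mem_enum -[i](permKV t) map_f // mem_enum.
Qed.

Lemma perm_word_inj n : injective (@perm_word n).
Proof.
move=> s t E; apply/permP => i; apply: val_inj.
by rewrite /= -!nth_perm_word E.
Qed.

Lemma iota_perm_word n (x : seq nat) :
  perm_eq x (iota 0 n) -> exists t : 'S_n, x = perm_word t.
Proof.
move=> E; have Sx : size x = n by rewrite (perm_size E) size_iota.
have Ux : uniq x by rewrite (perm_uniq E) iota_uniq.
have lt (i : 'I_n) : (nth 0%N x i < n)%N.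
  have : nth 0%N x i \in x by rewrite mem_nth // Sx.
  by rewrite (perm_mem E) mem_iota.
have inj : injective (fun i => Ordinal (lt i)).
  move=> i j [] /eqP; rewrite nth_uniq ?Sx // => /eqP; exact: val_inj.
exists (perm inj); apply: (@eq_from_nth _ 0%N) => [|i].
  by rewrite size_perm_word.
by rewrite Sx => ltin; rewrite (nth_perm_word _ (Ordinal ltin)) permE.
Qed.

(** Trades the filter for a guard in the relation, so that positions of the unfiltered word can be
    used. *)
Lemma pairwise_filterE (T : Type) (p : pred T) (r : rel T) s :
  pairwise r (filter p s) = pairwise (fun x y => p x && p y ==> r x y) s.
Proof.
elim: s => //= a s IH; case: ifP => pa /=; rewrite IH.
  by rewrite all_filter; congr (_ && _); apply: eq_all => b.
by rewrite all_predT.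
Qed.

(** The letter [a] stands at position [t^-1 a] of the word of [t]; both sides say that the letters
    satisfying [p] occur there in increasing order. *)
Lemma filter_perm_wordP n (t : 'S_n) (p : pred nat) :
  reflect (forall a b : 'I_n, p a -> p b -> (a < b)%N -> ((t^-1)%g a < (t^-1)%g b)%N)
          (filter p (perm_word t) == filter p (iota 0 n)).
Proof.
have srt : sorted ltn (filter p (iota 0 n)).
  by apply: sorted_filter; [exact: ltn_trans | exact: iota_ltn_sorted].
apply: (iffP eqP) => [E a b pa pb ab|H].
  have: pairwise ltn (filter p (perm_word t)).
    by rewrite E -sorted_pairwise //; exact: ltn_trans.
  rewrite pairwise_filterE => /(pairwiseP 0%N) H; rewrite ltnNge leq_eqVlt.
  apply/negP => /orP[/eqP/val_inj/perm_inj ba|ba].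
    by move: ab; rewrite ba ltnn.
  have sz (i : 'I_n) : (i : nat) \in gtn (size (perm_word t)).
    by rewrite inE size_perm_word.
  have := H _ _ (sz ((t^-1)%g b)) (sz ((t^-1)%g a)) ba.
  by rewrite !nth_perm_word !permKV pa pb /= ltnNge ltnW.
(* Two strictly increasing lists with the same elements are equal. *)
apply: (irr_sorted_eq ltn_trans ltnn _ srt) => [|i].
  rewrite sorted_pairwise; last exact: ltn_trans.
  rewrite pairwise_filterE; apply/(pairwiseP 0%N) => i j.
  rewrite !inE size_perm_word => lti ltj ij.
  rewrite (nth_perm_word t (Ordinal lti)) (nth_perm_word t (Ordinal ltj)).
  apply/implyP => /andP[pi pj]; rewrite ltnNge leq_eqVlt.
  apply/negP => /orP[/eqP/val_inj/perm_inj [] ji|/(H _ _ pj pi)].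
    by move: ij; rewrite ji ltnn.
  by rewrite !permK /= ltnNge ltnW.
by rewrite !mem_filter (perm_mem (perm_word_iota t)).
Qed.

Lemma mem_shuffle_iota n m (x : seq nat) :
  x \in shuffle (iota 0 n) (iota n m) =
  (filter (gtn n) x == iota 0 n) && (filter (predC (gtn n)) x == iota n m).
Proof.
apply/idP/andP => [Hx|[/eqP <- /eqP <-]]; last exact: filter_shuffle.
apply/andP; apply: shuffle_filter Hx; apply/allP => i; rewrite mem_iota //=.
by rewrite -leqNgt => /andP[].
Qed.

(** As [q a] is the position of [a] in the word of [q^-1], monotonicity of [q] on a block means that
    the letters of this block appear in order in that word. *)
Lemma mem_Xset n m (q : 'S_(n + m)) :
  (q \in Xset (n + m) [:: n; m]) =
  (perm_word (q^-1)%g \in shuffle (iota 0 n) (iota n m)).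
Proof.
have E1 : filter (gtn n) (iota 0 (n + m)) = iota 0 n.
  exact: filter_iota_ltn (leq_addr m n).
have E2 : filter (predC (gtn n)) (iota 0 (n + m)) = iota n m.
  rewrite iotaD filter_cat add0n.
  rewrite (@eq_in_filter _ _ pred0) ?filter_pred0 => [|i]; last first.
    by rewrite mem_iota /= => ->.
  rewrite (@eq_in_filter _ _ predT) ?filter_predT // => i.
  by rewrite mem_iota /= -leqNgt => /andP[].
rewrite mem_shuffle_iota -E1 -E2.
apply/idP/andP.
  rewrite inE => /forallP H; split; apply/filter_perm_wordP => a b /= pa pb ab;
    rewrite !invgK.
    (* Index 0 of the composition is the block below [n]; index 1, written [lift ord0 ord0], is the
       rest. *)
    have /forallP/(_ a)/forallP/(_ b) := H ord0.
    by rewrite /= addn0 ab pb.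
  have /forallP/(_ a)/forallP/(_ b) := H (lift ord0 ord0).
  by rewrite /= !addn0 ab -[(n <= a)%N]negbK -ltnNge pa ltn_ord.
case=> /filter_perm_wordP H1 /filter_perm_wordP H2; rewrite !invgK in H1 H2.
rewrite inE; apply/forallP => i; apply/forallP => a; apply/forallP => b.
apply/implyP => /and3P[]; case: i => -[|[|//]] lti /=; rewrite !addn0.
  by move=> _ ab bn; apply: H1 => //=; exact: ltn_trans bn.
move=> na ab _; apply: H2 => //=; rewrite -leqNgt //.
exact: leq_trans (ltnW ab).
Qed.

(** Neither list has repetitions, so a sum over X_(n,m) becomes a sum over shuffles. *)
Lemma shuffle_iota_perm n m :
  perm_eq (shuffle (iota 0 n) (iota n m))
          [seq perm_word (q^-1)%g | q <- enum (Xset (n + m) [:: n; m])].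
Proof.
apply: uniq_perm => [||x].
- apply: (shuffle_uniq (P := gtn n)); apply/allP => i; rewrite mem_iota //=.
  by rewrite -leqNgt => /andP[].
- rewrite map_inj_uniq ?enum_uniq // => s t /perm_word_inj; exact: invg_inj.
apply/idP/mapP => [Hx|[q]]; last by rewrite mem_enum mem_Xset => Hq ->.
have [t Et] : exists t : 'S_(n + m), x = perm_word t.
  by apply: iota_perm_word; rewrite iotaD; exact: shuffle_perm.
exists (t^-1)%g; last by rewrite invgK.
by rewrite mem_enum mem_Xset invgK -Et.
Qed.

(** * Words encoding generators, and their coproduct *)

Section Words.
Variables (K : comPzRingType) (V : lmodType K).
Local Notation letter := (V * nat)%type.
Local Notation x0 := (0, 0%N : nat).
Local Notation FV := (dsum (F V)).
Implicit Types (u x y z : seq letter).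

(** The length [n] is kept apart from [size u], to which it is often only provably equal; this
    avoids casts of ordinals. *)
Definition word_letter u (n : nat) (i : 'I_n) : nat := (nth x0 u i).2.

(** The inverse appears because the numbers of a word stand for the values of [s^-1]. *)
Definition wordF u : FV :=
  dinj (fpure [ffun i : 'I_(size u) => (nth x0 u i).1]
              (std (@word_letter u (size u)))^-1%g).

(** Reduces an equality of generators to comparisons of numbers, with no explicit standardization
    and no transport along [size u = n]. *)
Lemma wordFE n (v : {ffun 'I_n -> V}) (s : 'S_n) u :
  size u = n -> (forall i : 'I_n, (nth x0 u i).1 = v i) ->
  (forall i j : 'I_n, ((s^-1)%g i < (s^-1)%g j)%N = std_before (@word_letter u n) i j) ->
  wordF u = dinj (fpure v s).
Proof.
move=> E; case: n / E v s => v s Ev Es; rewrite /wordF (std_unique Es) invgK.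
by congr (dinj (fpure _ _)); apply/ffunP => i; rewrite ffunE Ev.
Qed.

Lemma fcop_wordF u :
  fcop V (wordF u) = \sum_(p <- splits u) wordF p.1 \ox wordF p.2.
Proof.
rewrite fcopE splitsE big_map.
rewrite -[iota _ _]/(index_iota 0 (size u).+1) big_mkord.
apply: eq_bigr => p _; have le : (p <= size u)%N := ltn_ord p.
congr (_ \ox _); apply/esym/wordFE => [|i|i j].
- by rewrite size_takel.
- by rewrite nth_take // ffunE /wtake ffunE.
- rewrite /pileft !invgK std_ltE.
  (* The prefix is read off through the increasing inclusion [f] of positions, so that
     [std_before_std] applies; the suffix is treated alike. *)
  pose w := @word_letter u (size u).
  pose f := widen_ord (ltn_ord p : (p <= size u)%N).
  transitivity (std_before (fun k => w (f k)) i j); first exact: std_before_std.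
  by rewrite /std_before /word_letter !nth_take.
- by rewrite size_drop.
- by rewrite nth_drop ffunE /wdrop ffunE.
- rewrite /piright !invgK std_ltE.
  pose w := @word_letter u (size u).
  pose f k := cast_ord (subnKC (ltn_ord p : (p <= size u)%N)) (rshift p k).
  transitivity (std_before (fun k => w (f k)) i j).
    by apply: std_before_std => k l; rewrite /= ltn_add2l.
  by rewrite /std_before /word_letter !nth_drop.
Qed.

Lemma fcounit_wordF u : fcounit V (wordF u) = (nilp u)%:R.
Proof.
rewrite -[LHS]/(F0_to (dcomp (wordF u) 0%N)) /wordF.
case: u => [|a u] /=; last by rewrite dfwith_out // [LHS](linear0 (linof (@F0_to_linear K V))).
by rewrite dfwith_in [LHS](fextE (@F0_multilin _ V)).
Qed.

Lemma funit1 : funit V 1 = wordF [::].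
Proof.
rewrite -[LHS]/(dinj (1 *: _)) scale1r; apply/esym/wordFE => //; first by case.
by case.
Qed.

(* The letters are shifted so that generators can be made to have words with
   disjoint sets of letters. *)
Definition shifted_word k n (v : {ffun 'I_n -> V}) (s : 'S_n) : seq letter :=
  [seq (v i, k + (s^-1)%g i)%N | i <- enum 'I_n].

(** A shift preserves comparisons and the numbers [s^-1 i] are distinct, so standardization returns
    [s^-1] for every [k]. *)
Lemma wordF_shifted k n (v : {ffun 'I_n -> V}) (s : 'S_n) :
  wordF (shifted_word k v s) = dinj (fpure v s).
Proof.
have N (i : 'I_n) : nth x0 (shifted_word k v s) i = (v i, k + (s^-1)%g i)%N.
  by rewrite (nth_map i) ?nth_ord_enum // size_enum_ord.
apply: wordFE => [|i|i j]; rewrite ?N //; first by rewrite size_map size_enum_ord.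
rewrite /std_before /word_letter /= !N /= ltEnat /= ltn_add2l eqn_add2l.
case: eqP => [/val_inj E|]; last by rewrite orbF.
move/perm_inj: E => ->.
by rewrite !ltnn.
Qed.

Lemma shifted_word_letters k n (v : {ffun 'I_n -> V}) (s : 'S_n) :
  perm_eq (map snd (shifted_word k v s)) (iota k n).
Proof.
have -> : map snd (shifted_word k v s) = map (addn k \o val) (map (s^-1)%g (enum 'I_n)).
  by rewrite -!map_comp.
rewrite -[k in iota k]addn0 iotaDl -val_enum_ord map_comp; apply/perm_map/perm_map.
apply: uniq_perm => [||i]; rewrite ?(map_inj_uniq (@perm_inj _ _)) ?enum_uniq //.
by rewrite mem_enum -[i](permK s) map_f // mem_enum.
Qed.

(** * The product of separated words *)

Lemma gact_xelt n c (p : F V n) :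
  Defs.gact (xelt K n c) p = \sum_(q in Xset n c) Defs.gact (gdelta K q) p.
Proof. exact: (linear_sum (linof ((@gact_bilin K V n).1 p))). Qed.

Definition separated u u' : bool :=
  [&& uniq (map snd u), uniq (map snd u')
    & allrel ltn (map snd u) (map snd u')].

Lemma separated_cat_uniq u u' : separated u u' -> uniq (map snd (u ++ u')).
Proof.
case/and3P => Uu Uu' /allrelP lt; rewrite map_cat cat_uniq Uu Uu' andbT.
by apply/hasPn => k ku'; apply/negP => ku; have /= := lt _ _ ku ku'; rewrite ltnn.
Qed.

Lemma sprodV n m (s : 'S_n) (s' : 'S_m) :
  (sprod s s')^-1%g = sprod s^-1%g s'^-1%g.
Proof.
apply/eqP; rewrite eq_invg_mul; apply/eqP/permP => i.
rewrite permM perm1 !permE /sprod_fun -[in RHS](splitK i).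
case: (split i) => j /=.
  by rewrite (unsplitK (inl (s j) : 'I_n + 'I_m)) permK.
by rewrite (unsplitK (inr (s' j) : 'I_n + 'I_m)) permK.
Qed.

(** Inside a block this is [std_ltE]; across the blocks both sides are decided by separation. Thus
    [u ++ u'] standardizes to the [sprod] of the two standardizations. *)
Lemma sprod_std_ltE u u' (a b : 'I_(size u + size u')) :
  separated u u' ->
  (sprod (std (@word_letter u (size u))) (std (@word_letter u' (size u'))) a <
   sprod (std (@word_letter u (size u))) (std (@word_letter u' (size u'))) b)%N =
  std_before (@word_letter (u ++ u') (size u + size u')) a b.
Proof.
case/and3P => _ _ /allrelP lt.
have lt2 (i : 'I_(size u)) (j : 'I_(size u')) :
    ((nth x0 u i).2 < (nth x0 u' j).2)%N.
  by apply: lt; apply/map_f/mem_nth.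
rewrite !permE /sprod_fun /std_before /word_letter !nth_cat.
case: (splitP a) => i ->; case: (splitP b) => j -> /=;
  rewrite ?ltn_ord ?ltnNge ?leq_addr /= ?addKn -?ltnNge.
- by rewrite std_ltE.
- by rewrite ltn_addr // ltEnat /= lt2.
- rewrite ltnNge ltnW ?ltn_addr // ltEnat /= ltnNge ltnW ?lt2 //=.
  by rewrite gtn_eqF ?lt2.
- by rewrite !ltn_add2l std_ltE.
Qed.

(** Acting by [q] on the generator of [u ++ u'] gives the word that reads [u ++ u'] at the positions
    [q^-1(0)], [q^-1(1)], and so on; for [q] in X_(n,m) these words are the shuffles. *)
Lemma fmul_wordF u u' : separated u u' ->
  fmul V (wordF u \ox wordF u') = \sum_(x <- shuffle u u') wordF x.
Proof.
move=> sep; have Uc := separated_cat_uniq sep.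
set n := size u; set m := size u'; set c := u ++ u'.
have Sc : size c = (n + m)%N by rewrite size_cat.
(* Positions are shuffled in place of letters, to reach the form of [shuffle_iota_perm]. *)
have -> : shuffle u u' =
    map (map (nth x0 c)) (shuffle (iota 0 n) (iota n m)).
  rewrite -shuffle_map; congr (shuffle _ _); apply: (@eq_from_nth _ x0).
  - by rewrite size_map size_iota.
  - move=> i lti; rewrite (nth_map 0%N) ?size_iota // nth_iota // add0n.
    by rewrite nth_cat lti.
  - by rewrite size_map size_iota.
  - move=> i lti; rewrite (nth_map 0%N) ?size_iota // nth_iota //.
    by rewrite nth_cat ltnNge leq_addr addKn.
rewrite big_map (perm_big _ (shuffle_iota_perm n m)) big_map big_enum [RHS]/=.
rewrite [in LHS]/wordF fmulE fmulhE gact_xelt linear_sum; apply: eq_bigr => q _ /=.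
rewrite gactE; apply/esym; apply: wordFE.
- by rewrite size_map size_perm_word.
- move=> i; rewrite (nth_map 0%N) ?size_perm_word // nth_perm_word !ffunE /c nth_cat.
  by case: (splitP (q^-1%g i)) => j ->; rewrite ?ltn_ord ?ltnNge ?leq_addr /= ?addKn ffunE.
move=> i j; rewrite invMg sprodV !invgK !permM sprod_std_ltE //.
rewrite /std_before /word_letter -/c !(nth_map 0%N) ?size_perm_word // !nth_perm_word.
case: (eqVneq (nth x0 c (q^-1%g i)).2 (nth x0 c (q^-1%g j)).2) => //= E.
(* The numbers of [c] are distinct, so a tie can only occur between a position and itself. *)
have /val_inj/perm_inj -> : (q^-1%g i : nat) = q^-1%g j; last by rewrite !ltnn.
apply/eqP; rewrite -(nth_uniq 0%N _ _ Uc) ?size_map ?Sc //.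
by rewrite !(nth_map x0) ?Sc // E.
Qed.

Lemma separated_subseq u u' z z' :
  subseq u u' -> subseq z z' -> separated u' z' -> separated u z.
Proof.
move=> /(map_subseq snd) su /(map_subseq snd) sz /and3P[Uu Uz /allrelP lt].
rewrite /separated (subseq_uniq su) // (subseq_uniq sz) //=.
by apply/allrelP => i j /(mem_subseq su) Hi /(mem_subseq sz); exact: lt.
Qed.

Lemma separated_splits u z p q : p \in splits u -> q \in splits z ->
  separated u z -> separated p.1 q.1 && separated p.2 q.2.
Proof.
rewrite !splitsE => /mapP[i _ ->] /mapP[j _ ->] sep /=.
by rewrite !(separated_subseq _ _ sep) ?take_subseq ?drop_subseq.
Qed.

(** A shuffle has the numbers of [y] and [z] together. This and [separated_shufflel] allow products
    to be iterated. *)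
Lemma separated_shuffler u y z x : separated u y -> separated u z ->
  separated y z -> x \in shuffle y z -> separated u x.
Proof.
move=> /and3P[Uu _ /allrelP uy] /and3P[_ _ /allrelP uz] /separated_cat_uniq Uyz.
move=> /shuffle_perm/(perm_map snd) E; rewrite /separated Uu (perm_uniq E) Uyz /=.
apply/allrelP => i j Hi; rewrite (perm_mem E) map_cat mem_cat.
by case/orP; [exact: uy | exact: uz].
Qed.

Lemma separated_shufflel u y z x : separated y u -> separated z u ->
  separated y z -> x \in shuffle y z -> separated x u.
Proof.
move=> /and3P[_ Uu /allrelP uy] /and3P[_ _ /allrelP uz] /separated_cat_uniq Uyz.
move=> /shuffle_perm/(perm_map snd) E; rewrite /separated Uu (perm_uniq E) Uyz /=.
apply/allrelP => i j; rewrite (perm_mem E) map_cat mem_cat.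
by case/orP; [exact: uy | exact: uz].
Qed.

Lemma separated_shifted k n (v : {ffun 'I_n -> V}) s k' m (v' : {ffun 'I_m -> V}) s' :
  (k + n <= k')%N ->
  separated (shifted_word k v s) (shifted_word k' v' s').
Proof.
move=> le; have E := shifted_word_letters k v s.
have E' := shifted_word_letters k' v' s'.
rewrite /separated (perm_uniq E) (perm_uniq E') !iota_uniq /=.
apply/allrelP => i j; rewrite (perm_mem E) (perm_mem E') !mem_iota.
move=> /andP[_ Hi] /andP[Hj _]; exact: leq_trans (leq_trans Hi le) Hj.
Qed.

(** * The axioms, checked on generators and extended linearly *)

Lemma dsum_F_ext (W : lmodType K) (g h : FV -> W) :
  linear g -> linear h ->
  (forall n (v : {ffun 'I_n -> V}) s, g (dinj (fpure v s)) = h (dinj (fpure v s))) ->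
  forall f, g f = h f.
Proof.
move=> Hg Hh E f; have [N ->] := dsum_decomp f.
rewrite !linear_sum_seq //; apply: eq_bigr => i _.
elim/F_ind: (f i) => [v s||a p q Hp Hq]; first exact: E.
- by rewrite linear0 [LHS](linear0 (linof Hg)) [RHS](linear0 (linof Hh)).
- by rewrite linearP Hg Hh Hp Hq.
Qed.

Lemma mul_bilin : bilin (fun p q : FV => fmul V (p \ox q)).
Proof.
have [Hl Hr] := tpure_bilin FV FV.
by split=> [q|p] a r r'; rewrite ?Hl ?Hr linearP.
Qed.

Lemma fmulA (p q r : FV) :
  fmul V (p \ox fmul V (q \ox r)) = fmul V (fmul V (p \ox q) \ox r).
Proof.
have [Hl Hr] := mul_bilin.
move: p; apply: dsum_F_ext => [||n v s]; [exact: Hl | |].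
  by apply: (linear_comp_fun (Hl r)); exact: Hl.
move: q; apply: dsum_F_ext => [||m v' s'].
- by apply: (linear_comp_fun (Hr _)); exact: Hl.
- by apply: (linear_comp_fun (Hl r)); exact: Hr.
move: r; apply: dsum_F_ext => [||l v'' s'']; [|exact: Hr|].
  by apply: (linear_comp_fun (Hr _)); exact: Hr.
(* These shifts put the numbers of the three words into consecutive disjoint intervals, so that each
   pair is separated. *)
rewrite -(wordF_shifted 0) -(wordF_shifted n v') -(wordF_shifted (n + m) v'').
have H1 := separated_shifted v s v' s' (leqnn (0 + n)).
have H2 := separated_shifted v' s' v'' s'' (leqnn (n + m)).
have H3 := separated_shifted v s v'' s'' (leq_addr m (0 + n)).
rewrite add0n in H1 H3; rewrite !fmul_wordF //.
rewrite (linear_sum_seq _ _ (Hr _)) (linear_sum_seq _ _ (Hl _)).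
under eq_big_seq => x Hx do rewrite fmul_wordF ?(separated_shuffler H1 H3 H2 Hx) //.
under [RHS]eq_big_seq => x Hx do rewrite fmul_wordF ?(separated_shufflel H3 H2 H1 Hx) //.
exact: shuffleA_sum.
Qed.

Lemma fmul1l (p : FV) : fmul V (funit V 1 \ox p) = p.
Proof.
have [Hl Hr] := mul_bilin.
move: p; apply: dsum_F_ext => [||n v s]; [exact: Hr|exact: linear_of idfun|].
rewrite -(wordF_shifted 0) funit1 fmul_wordF ?shuffle0s ?big_seq1 //.
by rewrite /separated (perm_uniq (shifted_word_letters _ _ _)) iota_uniq.
Qed.

Lemma fmul1r (p : FV) : fmul V (p \ox funit V 1) = p.
Proof.
have [Hl Hr] := mul_bilin.
move: p; apply: dsum_F_ext => [||n v s]; [exact: Hl|exact: linear_of idfun|].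
rewrite -(wordF_shifted 0) funit1 fmul_wordF ?shuffles0 ?big_seq1 //.
rewrite /separated (perm_uniq (shifted_word_letters _ _ _)) iota_uniq /=.
by apply/allrelP.
Qed.

(** On a word, both sides are sums over its cuts into three factors, as in [splitsA_sum]. *)
Lemma fcop_coassoc (p : FV) :
  tmap idfun (fcop V) (fcop V p) = tassoc (tmap (fcop V) idfun (fcop V p)).
Proof.
have Lc := linear_of (fcop V).
have La : linear (@tassoc K FV FV FV) by exact/text_linear/tassoc_bilin.
have L1 : linear (tmap (idfun : FV -> FV) (fcop V)) by exact: tmap_linear.
have L2 : linear (tmap (fcop V) (idfun : FV -> FV)) by exact: tmap_linear.
move: p; apply: dsum_F_ext => [||n v s].
- exact: linear_comp_fun.
- by apply: linear_comp_fun => //; exact: linear_comp_fun.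
have [Hl _] := tpure_bilin (tens FV FV) FV.
have [_ Hr] := tpure_bilin FV (tens FV FV).
rewrite -(wordF_shifted 0) fcop_wordF !linear_sum_seq //.
under eq_bigr do rewrite tmapE fcop_wordF (linear_sum_seq _ _ (Hr _)).
under [RHS]eq_bigr do rewrite tmapE fcop_wordF (linear_sum_seq _ _ (Hl _)).
under [RHS]eq_bigr do rewrite linear_sum_seq //.
under [RHS]eq_bigr do under eq_bigr do rewrite tassocE.
exact: (splitsA_sum _ (fun x y z => wordF x \ox (wordF y \ox wordF z))).
Qed.

Lemma fcop_counitl (p : FV) :
  text (fun (k : K^o) (q : FV) => (k : K) *: q)
    (tmap (fcounit V) idfun (fcop V p)) = p.
Proof.
have Lc := linear_of (fcop V).
have B : bilin (fun (k : K^o) (q : FV) => (k : K) *: q).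
  by split=> [q|k] a r r'; rewrite ?scalerDr ?scalerDl ?scalerA //= mulrC.
have L1 : linear (tmap (fcounit V) (idfun : FV -> FV)) by exact: tmap_linear.
have L2 := text_linear B.
move: p; apply: dsum_F_ext => [|//|n v s].
  by apply: linear_comp_fun => //; exact: linear_comp_fun.
rewrite -(wordF_shifted 0) fcop_wordF !linear_sum_seq //.
under eq_bigr do rewrite tmapE textE // fcounit_wordF.
exact: splits_counitl.
Qed.

Lemma fcop_counitr (p : FV) :
  text (fun (q : FV) (k : K^o) => (k : K) *: q)
    (tmap idfun (fcounit V) (fcop V p)) = p.
Proof.
have Lc := linear_of (fcop V).
have B : bilin (fun (q : FV) (k : K^o) => (k : K) *: q).
  by split=> [k|q] a r r'; rewrite ?scalerDr ?scalerDl ?scalerA //= mulrC.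
have L1 : linear (tmap (idfun : FV -> FV) (fcounit V)) by exact: tmap_linear.
have L2 := text_linear B.
move: p; apply: dsum_F_ext => [|//|n v s].
  by apply: linear_comp_fun => //; exact: linear_comp_fun.
rewrite -(wordF_shifted 0) fcop_wordF !linear_sum_seq //.
under eq_bigr do rewrite tmapE textE // fcounit_wordF.
exact: splits_counitr.
Qed.

(** On separated words this is [splits_shuffle_sum]; the halves of their cuts stay separated, so the
    products on the right expand into shuffles too. *)
Lemma fcopM (p q : FV) :
  fcop V (fmul V (p \ox q)) = tmul (fmul V) (fcop V p) (fcop V q).
Proof.
have [Hl Hr] := mul_bilin; have [Tl Tr] := tmul_bilin (fmul V).
have [Pl Pr] := tpure_bilin FV FV.
have Lc := linear_of (fcop V).
move: p; apply: dsum_F_ext => [||n v s].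
- by apply: (linear_comp_fun Lc); exact: Hl.
- exact: (linear_comp_fun (Tl _) Lc).
move: q; apply: dsum_F_ext => [||m v' s'].
- by apply: (linear_comp_fun Lc); exact: Hr.
- exact: (linear_comp_fun (Tr _) Lc).
rewrite -(wordF_shifted 0) -(wordF_shifted n v').
have sep := separated_shifted v s v' s' (leqnn (0 + n)); rewrite add0n in sep.
rewrite fmul_wordF // !fcop_wordF (linear_sum_seq _ _ Lc).
under eq_bigr do rewrite fcop_wordF.
rewrite (splits_shuffle_sum _ _ (fun y z => wordF y \ox wordF z)).
rewrite (linear_sum_seq _ _ (Tl _)); apply: eq_big_seq => x Hx.
rewrite (linear_sum_seq _ _ (Tr _)); apply: eq_big_seq => y Hy.
have /andP[sep1 sep2] := separated_splits Hx Hy sep.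
rewrite tmulE !fmul_wordF // (linear_sum_seq _ _ (Pl _)).
by apply: eq_bigr => z _; rewrite (linear_sum_seq _ _ (Pr _)).
Qed.

Lemma fcounitM (p q : FV) :
  fcounit V (fmul V (p \ox q)) = fcounit V p * fcounit V q.
Proof.
have [Hl Hr] := mul_bilin.
have Lc := linear_of (fcounit V).
move: p; apply: dsum_F_ext => [||n v s].
- by apply: (linear_comp_fun Lc); exact: Hl.
(* Scaling in [K^o] is multiplication, so homogeneity amounts to associativity, and to [mulrCA] in
   the second variable. *)
- by move=> a r r'; rewrite Lc mulrDl; congr (_ + _); exact: esym (mulrA _ _ _).
move: q; apply: dsum_F_ext => [||m v' s'].
- by apply: (linear_comp_fun Lc); exact: Hr.
- by move=> a r r'; rewrite Lc mulrDr; congr (_ + _); exact: mulrCA.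
rewrite -(wordF_shifted 0) -(wordF_shifted n v').
have sep := separated_shifted v s v' s' (leqnn (0 + n)); rewrite add0n in sep.
rewrite fmul_wordF // (linear_sum_seq _ _ Lc) !fcounit_wordF.
under eq_bigr do rewrite fcounit_wordF.
exact: shuffle_counit.
Qed.

(** Each summand for a generator lies in degrees [p] and [n - p] by construction, and the witnesses
    combine linearly. *)
Lemma fcop_homog n (p : F V n) : homog2 n (fcop V (dinj p)).
Proof.
elim/F_ind: p => [v s||a p q [w Hw] [w' Hw']].
- exists (fun p => fpure (finfun (wtake p v)) (pileft s p) \ox
                   fpure (finfun (wdrop p v)) (piright s p)).
  by rewrite fcopE; apply: eq_bigr => p _; rewrite tmapE.
- exists (fun p => 0); rewrite !linear0 big1 // => p _.
  exact: (linear0 (linof (tmap_linear _ _))).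
- exists (fun p => a *: w p + w' p).
  rewrite !linearP Hw Hw' scaler_sumr -big_split; apply: eq_bigr => i _ /=.
  by rewrite tmap_linear.
Qed.

End Words.

Theorem theorem1p1 (K : comPzRingType) (V : lmodType K) :
  graded_bialgebra (fmul V) (funit V) (fcop V) (fcounit V).
Proof.
split; first split.
- exact: fmulA.
- exact: fmul1l.
- exact: fmul1r.
- exact: fcop_coassoc.
- exact: fcop_counitl.
- exact: fcop_counitr.
- exact: fcopM.
- by rewrite funit1 fcop_wordF big_seq1.
- exact: fcounitM.
- by rewrite funit1 fcounit_wordF.
- by move=> m n p q; exists (fmulh p q); exact: fmulE.
- by move=> k; exists (F0_of V k).
- exact: fcop_homog.
(* The counit reads the component of degree 0, which vanishes for an element placed in degree
   [n <> 0]. *)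
- move=> n p n0; rewrite -[LHS]/(F0_to (dcomp (dinj p) 0%N)) /= dfwith_out.
    exact: (linear0 (linof (@F0_to_linear K V))).
  exact/eqP.
Qed.
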